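(* Let $\mathbb K$ be a field, let $f:\mathbb N^k\to\mathbb N^\ell$ be a surjective monoid homomorphism, and let $\Gamma$ be a row-finite $\ell$-graph with no sources and finitely many vertices which is strongly aperiodic. Put $A=\mathrm{KP}_{\mathbb K}(f^*\Gamma)$, $H=\ker\bar f$, $C=\mathbb K[H]$, and for $T\in\mathrm{MT}(\Gamma)$, $\mathfrak m\in\mathrm{MaxSpec}\,C$ put $P_{T,\mathfrak m}=I_{H_T}+A\,\iota(\mathfrak m)$. Let $$\Phi:\mathrm{MT}(\Gamma)\times\mathrm{MaxSpec}\,C\longrightarrow\mathrm{Prim}\,A,\qquad (T,\mathfrak m)\longmapsto P_{T,\mathfrak m}.$$ Give $\mathrm{MT}(\Gamma)$ the topology with basis $\mathcal S(v)=\{T\in\mathrm{MT}(\Gamma):v\in T\}$ $(v\in\Gamma^0)$, $\mathrm{MaxSpec}\,C$ the Zariski topology, the product the product topology, and $\mathrm{Prim}\,A$ the hull-kernel topology. For every field $\mathbb K$, the map $\Phi$ is a homeomorphism onto its image. If $\mathbb K$ is uncountable and algebraically closed, then $\Phi$ is a homeomorphism onto $\mathrm{Prim}\,A$, and for all $T\in\mathrm{MT}(\Gamma)$ and $\mathfrak m\in\mathrm{MaxSpec}\,C$, $$\overline{\{P_{T,\mathfrak m}\}}=\{P_{S,\mathfrak m}:S\in\mathrm{MT}(\Gamma),\ S\subseteq T\}.$$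
   Context: $\mathbb N$ contains $0$. A $k$-graph is a countable small category $\Lambda$ with a functor $d:\Lambda\to\mathbb N^k$ satisfying the factorisation property: if $d(\lambda)=m+n$ there are unique composable $\mu,\nu$ with $\lambda=\mu\nu$, $d(\mu)=m$, $d(\nu)=n$. Objects are identified with $\Lambda^0=d^{-1}(0)$ (vertices); $r,s$ are range and source, and $\mu\nu$ is defined when $s(\mu)=r(\nu)$. Put $v\Lambda^n=\{\lambda: d(\lambda)=n,\ r(\lambda)=v\}$ and $v\Lambda w=\{\lambda:r(\lambda)=v,\ s(\lambda)=w\}$. $\Lambda$ is row-finite if every $v\Lambda^n$ is finite, and has no sources if every $v\Lambda^n$ is nonempty. For a commutative unital ring $R$ and a row-finite $k$-graph $\Lambda$ with no sources, $\mathrm{KP}_R(\Lambda)$ is the universal $R$-algebra generated by $\{p_v:v\in\Lambda^0\}\cup\{s_\lambda,s_{\lambda^*}:\lambda\in\Lambda\setminus\Lambda^0\}$, with $s_v=s_{v^*}=p_v$, subject to: (KP1) the $p_v$ are mutually orthogonal idempotents; (KP2) $s_\lambda s_\mu=s_{\lambda\mu}$ and $s_{\mu^*}s_{\lambda^*}=s_{(\lambda\mu)^*}$ whenever $\lambda\mu$ is defined, and $p_{r(\lambda)}s_\lambda=s_\lambda=s_\lambda p_{s(\lambda)}$, $p_{s(\lambda)}s_{\lambda^*}=s_{\lambda^*}=s_{\lambda^*}p_{r(\lambda)}$; (KP3) if $d(\lambda)=d(\mu)$ then $s_{\lambda^*}s_\mu=\delta_{\lambda,\mu}p_{s(\lambda)}$;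 (KP4) $p_v=\sum_{\lambda\in v\Lambda^n}s_\lambda s_{\lambda^*}$ for $v\in\Lambda^0$, $0\ne n\in\mathbb N^k$. It is unital, with $1=\sum_v p_v$, when $\Lambda^0$ is finite. Infinite paths: $\Gamma^\infty$ is the set of degree-preserving functors $x:\{(p,q):p\le q\in\mathbb N^\ell\}\to\Gamma$ (with $d(x(p,q))=q-p$); $x(n)=x(n,n)$, $v\Gamma^\infty=\{x:x(0)=v\}$, and $(\sigma^mx)(p,q)=x(p+m,q+m)$. An $\ell$-graph $\Gamma$ is aperiodic if for every $v\in\Gamma^0$ there is $x\in v\Gamma^\infty$ with $\sigma^mx\ne\sigma^nx$ whenever $m\ne n$. A set $L\subseteq\Gamma^0$ is hereditary if $v\in L$, $v\Gamma w\ne\varnothing$ imply $w\in L$; it is saturated if $v\in L$ whenever $s(v\Gamma^n)\subseteq L$ for some $0\ne n\in\mathbb N^\ell$. For saturated hereditary $L$, $\Gamma\setminus L=\{\lambda\in\Gamma:s(\lambda)\notin L\}$, an $\ell$-graph with vertex set $\Gamma^0\setminus L$. $\Gamma$ is strongly aperiodic if $\Gamma\setminus L$ is aperiodic for every proper saturated hereditary $L\subsetneq\Gamma^0$. A maximal tail is a nonempty $T\subseteq\Gamma^0$ with: (MT1) $w\in T$, $v\Gamma w\ne\varnothing$ imply $v\in T$; (MT2) for $v\in T$, $n\in\mathbb N^\ell$ there is $\lambda\in v\Gamma^n$ with $s(\lambda)\in T$; (MT3) for $v,w\in T$ there is $z\in T$ with $v\Gamma z\ne\varnothing$ and $w\Gamma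 z\ne\varnothing$. $\mathrm{MT}(\Gamma)$ is the set of maximal tails. $H_T=\Gamma^0\setminus T$, and $I_{H_T}$ is the two-sided ideal of $A$ generated by $\{p_v:v\in H_T\}$. Pullback: $f^*\Gamma=\{(\lambda,n)\in\Gamma\times\mathbb N^k:d(\lambda)=f(n)\}$, a $k$-graph with degree $d(\lambda,n)=n$ and product $(\lambda,n)(\mu,m)=(\lambda\mu,n+m)$; vertices $(v,0)$ are identified with $v\in\Gamma^0$. $\bar f:\mathbb Z^k\to\mathbb Z^\ell$ is the group completion of $f$. $\mathbb K[H]$ is the group algebra with basis $u_h$ ($h\in H$), $u_hu_g=u_{h+g}$. For $h\in H$ write $h=h_+-h_-$ (coordinatewise positive and negative parts) and put $U_h=\sum_{v\in\Gamma^0}\sum_{\lambda\in v\Gamma^{f(h_+)}}s_{(\lambda,h_+)}s_{(\lambda,h_-)^*}\in A$ (note $f(h_+)=f(h_-)$). The map $\iota:\mathbb K[H]\to A$, $u_h\mapsto U_h$, is an injective unital homomorphism with central image. $\mathrm{Prim}\,A$ is the set of annihilators of simple left $A$-modules; its hull-kernel closed sets are $\{P:P\supseteq I\}$ for two-sided ideals $I$. $\mathrm{MaxSpec}\,C$ is the set of maximal ideals of $C$. Each $P_{T,\mathfrak m}$ is a primitive ideal of $A$, so $\Phi$ is well defined. *)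

(* Defs.v *)
From HB Require Import structures.
From mathcomp Require Import all_boot all_algebra finmap.
From mathcomp Require Import boolp classical_sets functions cardinality.
From mathcomp Require Import topology.
From mathcomp Require Import monalg zify.

Set Implicit Arguments.
Unset Strict Implicit.
Unset Printing Implicit Defensive.

Import GRing.Theory Num.Theory.

Local Open Scope classical_set_scope.
Local Open Scope ring_scope.

Notation natv k := {ffun 'I_k -> nat}.
Notation intv k := {ffun 'I_k -> int}.

Definition lev k (p q : natv k) : bool := [forall i, (p i <= q i)%N].
Definition subv k (q p : natv k) : natv k := [ffun i => (q i - p i)%N].

(* A two-sorted presentation of a countable small category with a degree
   functor.  Composition is in the order of paths: [comp lam mu] is meaningful
   when [src lam = rng mu], and its values elsewhere are junk which no axiom
   constrains.  By [factor], the morphisms of degree 0 are exactly the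
   identities, so [Obj] is the vertex set d^{-1}(0). *)
Record kgraph (k : nat) := KGraph {
  Obj : countType;
  Mor : countType;
  rng : Mor -> Obj;
  src : Mor -> Obj;
  idm : Obj -> Mor;
  comp : Mor -> Mor -> Mor;
  deg : Mor -> natv k;
  rng_id : forall v, rng (idm v) = v;
  src_id : forall v, src (idm v) = v;
  rng_comp : forall a b, src a = rng b -> rng (comp a b) = rng a;
  src_comp : forall a b, src a = rng b -> src (comp a b) = src b;
  comp_idl : forall a, comp (idm (rng a)) a = a;
  comp_idr : forall a, comp a (idm (src a)) = a;
  comp_assoc : forall a b c, src a = rng b -> src b = rng c ->
    comp a (comp b c) = comp (comp a b) c;
  deg_id : forall v, deg (idm v) = 0;
  deg_comp : forall a b, src a = rng b -> deg (comp a b) = deg a + deg b;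
  factor : forall a m n, deg a = m + n ->
    exists! bc : Mor * Mor,
      [/\ src bc.1 = rng bc.2, comp bc.1 bc.2 = a,
          deg bc.1 = m & deg bc.2 = n]
}.

Section KGraphTheory.
Context {k : nat} (G : kgraph k).

Definition vpaths (v : Obj G) (n : natv k) : set (Mor G) :=
  [set a | rng a = v /\ deg a = n].

Definition reach (v w : Obj G) : Prop :=
  exists a : Mor G, rng a = v /\ src a = w.

Definition row_finite : Prop := forall v n, finite_set (vpaths v n).

Definition no_sources : Prop := forall v n, vpaths v n !=set0.

Definition finite_vertices : Prop := finite_set [set: Obj G].

(* An infinite path is a function of the pairs p <= q only: values of [x]
   elsewhere are junk, and equality of paths is [eq_path]. *)
Definition infinite_path (x : natv k -> natv k -> Mor G) : Prop :=
  [/\ forall p q, lev p q -> deg (x p q) = subv q p,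
      forall p, x p p = idm (rng (x p p)),
      forall p q, lev p q -> rng (x p q) = rng (x p p) /\
                             src (x p q) = rng (x q q)
    & forall p q t, lev p q -> lev q t -> x p t = comp (x p q) (x q t)].

Definition eq_path (x y : natv k -> natv k -> Mor G) : Prop :=
  forall p q, lev p q -> x p q = y p q.

Definition shift (m : natv k) (x : natv k -> natv k -> Mor G) :=
  fun p q => x (p + m) (q + m).

Definition aperiodic : Prop :=
  forall v : Obj G, exists x, [/\ infinite_path x, rng (x 0 0) = v &
    forall m n, m <> n -> ~ eq_path (shift m x) (shift n x)].

Definition hereditary (L : set (Obj G)) : Prop :=
  forall v w, L v -> reach v w -> L w.

Definition saturated (L : set (Obj G)) : Prop :=
  forall v n, n != 0 -> (forall a, vpaths v n a -> L (src a)) -> L v.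

Definition maximal_tail : set (set (Obj G)) :=
  [set T | [/\ T !=set0,
     forall v w, T w -> reach v w -> T v,
     forall v n, T v -> exists2 a, vpaths v n a & T (src a)
   & forall v w, T v -> T w -> exists z, [/\ T z, reach v z & reach w z]]].

End KGraphTheory.

Section RemoveHereditary.
Context {k : nat} (G : kgraph k) (L : set (Obj G)) (herL : hereditary L).

Let rO : countType := {v : Obj G | v \in ~` L}.
Let rM : countType := {a : Mor G | src a \in ~` L}.

Fact rem_rng_subproof (a : rM) : rng (val a) \in ~` L.
Proof.
case: a => a /= /set_mem h; apply/mem_set => hr; apply: h.
by apply: herL hr _; exists a.
Qed.
Fact rem_idm_subproof (v : rO) : src (idm (val v)) \in ~` L.
Proof. by rewrite src_id; case: v. Qed.
Fact rem_comp_subproof (a b : rM) : src (val a) = rng (val b) ->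
  src (comp (val a) (val b)) \in ~` L.
Proof. by move=> h; rewrite src_comp //; case: b {h}. Qed.

Let r (a : rM) : rO := exist _ (rng (val a)) (rem_rng_subproof a).
Let s (a : rM) : rO := exist _ (src (val a)) (valP a).
Let i (v : rO) : rM := exist _ (idm (val v)) (rem_idm_subproof v).
Let c (a b : rM) : rM := insubd a (comp (val a) (val b)).

Let sr (a b : rM) : s a = r b -> src (val a) = rng (val b).
Proof. by move/(congr1 val). Qed.

Let val_c (a b : rM) : s a = r b -> val (c a b) = comp (val a) (val b).
Proof. by move=> h; rewrite val_insubd rem_comp_subproof // (sr h). Qed.

Fact rem_rng_id v : r (i v) = v.
Proof. by apply/val_inj; rewrite /= rng_id. Qed.
Fact rem_src_id v : s (i v) = v.
Proof. by apply/val_inj; rewrite /= src_id. Qed.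
Fact rem_rng_comp a b : s a = r b -> r (c a b) = r a.
Proof. by move=> h; apply/val_inj; rewrite /= val_c // rng_comp // (sr h). Qed.
Fact rem_src_comp a b : s a = r b -> s (c a b) = s b.
Proof. by move=> h; apply/val_inj; rewrite /= val_c // src_comp // (sr h). Qed.
Fact rem_comp_idl a : c (i (r a)) a = a.
Proof. by apply/val_inj; rewrite val_c ?rem_src_id //= comp_idl. Qed.
Fact rem_comp_idr a : c a (i (s a)) = a.
Proof. by apply/val_inj; rewrite val_c ?rem_rng_id //= comp_idr. Qed.
Fact rem_comp_assoc a b d : s a = r b -> s b = r d ->
  c a (c b d) = c (c a b) d.
Proof.
move=> h1 h2; apply/val_inj.
rewrite val_c ?rem_rng_comp // [RHS]val_c ?rem_src_comp // !val_c //.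
by apply: comp_assoc; [apply: sr h1 | apply: sr h2].
Qed.
Fact rem_deg_comp a b : s a = r b ->
  deg (val (c a b)) = deg (val a) + deg (val b).
Proof. by move=> h; rewrite val_c // deg_comp // (sr h). Qed.
Fact rem_factor (a : rM) m n : deg (val a) = m + n ->
  exists! bc : rM * rM,
    [/\ s bc.1 = r bc.2, c bc.1 bc.2 = a,
        deg (val bc.1) = m & deg (val bc.2) = n].
Proof.
move=> /factor [[b d] /= [[h1 h2 h3 h4] u]].
have hd : src d \in ~` L.
  by have := valP a; rewrite /= -[sval a]h2 src_comp.
have hb : src b \in ~` L.
  by rewrite h1; apply: (rem_rng_subproof (exist _ d hd)).
have e1 : s (exist _ b hb) = r (exist _ d hd) by apply/val_inj.
exists (exist _ b hb, exist _ d hd); split=> /=.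
  by split=> //; apply/val_inj; rewrite val_c.
move=> [b' d'] /= [g1 g2 g3 g4].
have /u [eb ed] : [/\ src (val b', val d').1 = rng (val b', val d').2,
   comp (val b', val d').1 (val b', val d').2 = val a,
   deg (val b', val d').1 = m & deg (val b', val d').2 = n].
  by split=> //=; [apply: sr g1 | rewrite -val_c // g2].
by congr pair; apply/val_inj.
Qed.

Definition remove : kgraph k :=
  @KGraph k rO rM r s i c (fun a => deg (val a))
    rem_rng_id rem_src_id rem_rng_comp rem_src_comp rem_comp_idl rem_comp_idr
    rem_comp_assoc (fun v => deg_id (val v)) rem_deg_comp rem_factor.

End RemoveHereditary.

Definition strongly_aperiodic k (G : kgraph k) : Prop :=
  forall (L : set (Obj G)) (herL : hereditary L),
    saturated L -> L <> setT -> aperiodic (remove herL).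

Section Pullback.
Context {k l : nat} (f : {additive natv k -> natv l}) (G : kgraph l).

Let pM : countType := {an : Mor G * natv k | deg an.1 == f an.2}.

Let r (a : pM) : Obj G := rng (val a).1.
Let s (a : pM) : Obj G := src (val a).1.
Fact pb_idm_subproof (v : Obj G) : deg (idm v, 0 : natv k).1 == f (idm v, 0).2.
Proof. by rewrite /= deg_id raddf0. Qed.
Let i (v : Obj G) : pM := exist _ (idm v, 0) (pb_idm_subproof v).
Let c (a b : pM) : pM :=
  insubd a (comp (val a).1 (val b).1, (val a).2 + (val b).2).
Let d (a : pM) : natv k := (val a).2.

Let val_c (a b : pM) : s a = r b ->
  val (c a b) = (comp (val a).1 (val b).1, (val a).2 + (val b).2).
Proof.
move=> h; rewrite val_insubd /= deg_comp //.
by rewrite (eqP (valP a)) (eqP (valP b)) raddfD eqxx.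
Qed.

Fact pb_rng_comp a b : s a = r b -> r (c a b) = r a.
Proof. by move=> h; rewrite /r val_c // rng_comp. Qed.
Fact pb_src_comp a b : s a = r b -> s (c a b) = s b.
Proof. by move=> h; rewrite /s val_c // src_comp. Qed.
Fact pb_comp_idl a : c (i (r a)) a = a.
Proof.
apply/val_inj; rewrite val_c ?[LHS]src_id //= comp_idl add0r.
by rewrite -surjective_pairing.
Qed.
Fact pb_comp_idr a : c a (i (s a)) = a.
Proof.
apply/val_inj; rewrite val_c ?[RHS]rng_id //= comp_idr addr0.
by rewrite -surjective_pairing.
Qed.
Fact pb_comp_assoc a b e : s a = r b -> s b = r e -> c a (c b e) = c (c a b) e.
Proof.
move=> h1 h2; apply/val_inj.
rewrite val_c ?pb_rng_comp // [RHS]val_c ?pb_src_comp // !val_c //=.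
by rewrite comp_assoc // addrA.
Qed.
Fact pb_deg_comp a b : s a = r b -> d (c a b) = d a + d b.
Proof. by move=> h; rewrite /d val_c. Qed.
Fact pb_factor a m n : d a = m + n ->
  exists! bc : pM * pM,
    [/\ s bc.1 = r bc.2, c bc.1 bc.2 = a, d bc.1 = m & d bc.2 = n].
Proof.
move=> da; have /factor[[b e] /= [[h1 h2 h3 h4] u]] :
  deg (val a).1 = f m + f n by rewrite (eqP (valP a)) -raddfD -da.
have hb : deg (b, m).1 == f (b, m).2 by rewrite /= h3.
have he : deg (e, n).1 == f (e, n).2 by rewrite /= h4.
exists (exist _ (b, m) hb, exist _ (e, n) he); split=> /=.
  by split=> //; apply/val_inj; rewrite val_c //= h2 -da -surjective_pairing.
move=> [b' e'] /= [g1 g2 g3 g4].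
have /u [eb ee] : [/\ src ((val b').1, (val e').1).1 =
                      rng ((val b').1, (val e').1).2,
   comp ((val b').1, (val e').1).1 ((val b').1, (val e').1).2 = (val a).1,
   deg ((val b').1, (val e').1).1 = f m & deg ((val b').1, (val e').1).2 = f n].
  split=> //=; first by rewrite -g2 val_c.
    by rewrite (eqP (valP b')) -g3.
  by rewrite (eqP (valP e')) -g4.
congr pair; apply/val_inj => /=.
  by rewrite eb -g3 -surjective_pairing.
by rewrite ee -g4 -surjective_pairing.
Qed.

Definition pullback : kgraph k :=
  @KGraph k (Obj G) pM r s i c d
    (@rng_id _ G) (@src_id _ G) pb_rng_comp pb_src_comp pb_comp_idl pb_comp_idr
    pb_comp_assoc (fun=> erefl) pb_deg_comp pb_factor.

(* The path (a, n), which exists when deg a = f n. *)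
Definition pb_path (a : Mor G) (n : natv k) : option (Mor pullback) :=
  insub (a, n).

End Pullback.

(* A Kumjian-Pask family in a not necessarily unital R-algebra, given as a
   module with a multiplication: [S a] is s_a and [S' a] is s_{a^*}, for all
   paths [a], with s_v = s_{v^*} = p_v on vertices.  The sum in [kpf4] is over
   a finite set when the k-graph is row-finite. *)
Record kp_family (R : comPzRingType) (k : nat) (L : kgraph k)
    (B : lmodType R) (mul : B -> B -> B)
    (P : Obj L -> B) (S S' : Mor L -> B) : Prop := KPFamily {
  kpf_id : forall v, S (idm v) = P v /\ S' (idm v) = P v;
  kpf1 : forall v w, mul (P v) (P w) = if v == w then P v else 0;
  kpf2 : forall a b, src a = rng b ->
    mul (S a) (S b) = S (comp a b) /\ mul (S' b) (S' a) = S' (comp a b);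
  kpf2r : forall a, mul (P (rng a)) (S a) = S a /\ mul (S a) (P (src a)) = S a;
  kpf2s : forall a,
    mul (P (src a)) (S' a) = S' a /\ mul (S' a) (P (rng a)) = S' a;
  kpf3 : forall a b, deg a = deg b ->
    mul (S' a) (S b) = if a == b then P (src a) else 0;
  kpf4 : forall v n, n != 0 ->
    P v = \sum_(a <- fset_set (vpaths v n)) mul (S a) (S' a)
}.

Section KumjianPask.
Context (R : comPzRingType) (k : nat) (L : kgraph k).

Inductive kp_term :=
  | KPp of Obj L
  | KPs of Mor L
  | KPs' of Mor L
  | KP0
  | KPadd of kp_term & kp_term
  | KPscale of R & kp_term
  | KPmul of kp_term & kp_term.

HB.instance Definition _ := gen_eqMixin kp_term.
HB.instance Definition _ := gen_choiceMixin kp_term.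

(* The least congruence making terms an associative, not necessarily unital,
   R-algebra in which the generators form a Kumjian-Pask family. *)
Inductive kp_eq : kp_term -> kp_term -> Prop :=
  | kpe_refl x : kp_eq x x
  | kpe_sym x y : kp_eq x y -> kp_eq y x
  | kpe_trans x y z : kp_eq x y -> kp_eq y z -> kp_eq x z
  | kpe_add x x' y y' : kp_eq x x' -> kp_eq y y' ->
      kp_eq (KPadd x y) (KPadd x' y')
  | kpe_scale c x x' : kp_eq x x' -> kp_eq (KPscale c x) (KPscale c x')
  | kpe_mul x x' y y' : kp_eq x x' -> kp_eq y y' ->
      kp_eq (KPmul x y) (KPmul x' y')
  | kpe_addA x y z : kp_eq (KPadd x (KPadd y z)) (KPadd (KPadd x y) z)
  | kpe_addC x y : kp_eq (KPadd x y) (KPadd y x)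
  | kpe_add0 x : kp_eq (KPadd KP0 x) x
  | kpe_scaleA b c x : kp_eq (KPscale b (KPscale c x)) (KPscale (b * c) x)
  | kpe_scale0 x : kp_eq (KPscale 0 x) KP0
  | kpe_scale1 x : kp_eq (KPscale 1 x) x
  | kpe_scaleDr c x y :
      kp_eq (KPscale c (KPadd x y)) (KPadd (KPscale c x) (KPscale c y))
  | kpe_scaleDl b c x :
      kp_eq (KPscale (b + c) x) (KPadd (KPscale b x) (KPscale c x))
  | kpe_mulA x y z : kp_eq (KPmul x (KPmul y z)) (KPmul (KPmul x y) z)
  | kpe_mulDl x y z : kp_eq (KPmul (KPadd x y) z) (KPadd (KPmul x z) (KPmul y z))
  | kpe_mulDr x y z : kp_eq (KPmul x (KPadd y z)) (KPadd (KPmul x y) (KPmul x z))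
  | kpe_scaleAl c x y : kp_eq (KPmul (KPscale c x) y) (KPscale c (KPmul x y))
  | kpe_scaleAr c x y : kp_eq (KPmul x (KPscale c y)) (KPscale c (KPmul x y))
  | kpe_id v : kp_eq (KPs (idm v)) (KPp v)
  | kpe_id' v : kp_eq (KPs' (idm v)) (KPp v)
  | kpe1 v w : kp_eq (KPmul (KPp v) (KPp w)) (if v == w then KPp v else KP0)
  | kpe2 a b : src a = rng b -> kp_eq (KPmul (KPs a) (KPs b)) (KPs (comp a b))
  | kpe2' a b : src a = rng b ->
      kp_eq (KPmul (KPs' b) (KPs' a)) (KPs' (comp a b))
  | kpe2r a : kp_eq (KPmul (KPp (rng a)) (KPs a)) (KPs a)
  | kpe2s a : kp_eq (KPmul (KPs a) (KPp (src a))) (KPs a)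
  | kpe2r' a : kp_eq (KPmul (KPs' a) (KPp (rng a))) (KPs' a)
  | kpe2s' a : kp_eq (KPmul (KPp (src a)) (KPs' a)) (KPs' a)
  | kpe3 a b : deg a = deg b ->
      kp_eq (KPmul (KPs' a) (KPs b)) (if a == b then KPp (src a) else KP0)
  | kpe4 v n : n != 0 ->
      kp_eq (KPp v) (\big[KPadd/KP0]_(a <- fset_set (vpaths v n))
                        KPmul (KPs a) (KPs' a)).

Definition kp_eqb : rel kp_term := fun x y => `[< kp_eq x y >].

Fact kp_eqb_refl : reflexive kp_eqb.
Proof. by move=> x; apply/asboolP; apply: kpe_refl. Qed.
Fact kp_eqb_sym : symmetric kp_eqb.
Proof. by move=> x y; apply/asboolP/asboolP; apply: kpe_sym. Qed.
Fact kp_eqb_trans : transitive kp_eqb.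
Proof.
by move=> y x z /asboolP h1 /asboolP h2; apply/asboolP; apply: kpe_trans h1 h2.
Qed.
Canonical kp_equiv := EquivRel kp_eqb kp_eqb_refl kp_eqb_sym kp_eqb_trans.

(* The Kumjian-Pask algebra, without reference to a unit. *)
Definition kp_alg := {eq_quot kp_equiv}%qT.
HB.instance Definition _ := EqQuotient.on kp_alg.
HB.instance Definition _ := Choice.on kp_alg.

Local Notation pi := (\pi_kp_alg)%qT.

Lemma kp_piP x y : kp_eq x y -> pi x = pi y.
Proof. by move=> h; apply/eqmodP/asboolP. Qed.

Let pi_inv x y : pi x = pi y -> kp_eq x y.
Proof. by move/eqmodP/asboolP. Qed.

Lemma kp_piW (P : kp_alg -> Prop) : (forall x, P (pi x)) -> forall x, P x.
Proof. by move=> h x; rewrite -[x]reprK. Qed.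

Let reprP x : kp_eq (repr (pi x)) x.
Proof. by apply: pi_inv; rewrite reprK. Qed.

Definition kp_add (x y : kp_alg) : kp_alg := pi (KPadd (repr x) (repr y)).
Definition kp_scale (c : R) (x : kp_alg) : kp_alg := pi (KPscale c (repr x)).
Definition kp_mul (x y : kp_alg) : kp_alg := pi (KPmul (repr x) (repr y)).
Definition kp_p (v : Obj L) : kp_alg := pi (KPp v).
Definition kp_s (a : Mor L) : kp_alg := pi (KPs a).
Definition kp_s' (a : Mor L) : kp_alg := pi (KPs' a).

Lemma kp_pi_add x y : pi (KPadd x y) = kp_add (pi x) (pi y).
Proof. by apply/kp_piP/kpe_add; apply: kpe_sym. Qed.
Lemma kp_pi_scale c x : pi (KPscale c x) = kp_scale c (pi x).
Proof. by apply/kp_piP/kpe_scale; apply: kpe_sym. Qed.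
Lemma kp_pi_mul x y : pi (KPmul x y) = kp_mul (pi x) (pi y).
Proof. by apply/kp_piP/kpe_mul; apply: kpe_sym. Qed.

Fact kp_addA : associative kp_add.
Proof.
elim/kp_piW=> x; elim/kp_piW=> y; elim/kp_piW=> z.
by rewrite -!kp_pi_add; apply/kp_piP/kpe_addA.
Qed.
Fact kp_addC : commutative kp_add.
Proof.
elim/kp_piW=> x; elim/kp_piW=> y.
by rewrite -!kp_pi_add; apply/kp_piP/kpe_addC.
Qed.
Fact kp_add0 : left_id (pi KP0) kp_add.
Proof. by elim/kp_piW=> x; rewrite -kp_pi_add; apply/kp_piP/kpe_add0. Qed.
Fact kp_addN : left_inverse (pi KP0) (kp_scale (-1)) kp_add.
Proof.
elim/kp_piW=> x; rewrite -kp_pi_scale -kp_pi_add; apply/kp_piP.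
apply: kpe_trans (kpe_scale0 x); rewrite -(addNr 1).
apply: kpe_trans (kpe_sym (kpe_scaleDl _ _ _)).
by apply: kpe_add; [apply: kpe_refl | apply/kpe_sym/kpe_scale1].
Qed.
HB.instance Definition _ :=
  GRing.isZmodule.Build kp_alg kp_addA kp_addC kp_add0 kp_addN.

Lemma kp_piD x y : pi (KPadd x y) = pi x + pi y.
Proof. exact: kp_pi_add. Qed.

Fact kp_scaleA b c x : kp_scale b (kp_scale c x) = kp_scale (b * c) x.
Proof.
elim/kp_piW: x => x; rewrite -!kp_pi_scale; exact/kp_piP/kpe_scaleA.
Qed.
Fact kp_scale1 : left_id 1 kp_scale.
Proof. by elim/kp_piW=> x; rewrite -kp_pi_scale; apply/kp_piP/kpe_scale1. Qed.
Fact kp_scaleDr : right_distributive kp_scale +%R.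
Proof.
move=> c; elim/kp_piW=> x; elim/kp_piW=> y.
by rewrite -kp_piD -!kp_pi_scale -kp_piD; apply/kp_piP/kpe_scaleDr.
Qed.
Fact kp_scaleDl x : {morph kp_scale^~ x : b c / b + c}.
Proof.
elim/kp_piW: x => x b c /=.
by rewrite -!kp_pi_scale -!kp_piD; apply/kp_piP/kpe_scaleDl.
Qed.
HB.instance Definition _ := GRing.Zmodule_isLmodule.Build R kp_alg
  kp_scaleA kp_scale1 kp_scaleDr kp_scaleDl.

Lemma kp_piZ c x : pi (KPscale c x) = c *: pi x.
Proof. exact: kp_pi_scale. Qed.

Lemma kp_mulA : associative kp_mul.
Proof.
elim/kp_piW=> x; elim/kp_piW=> y; elim/kp_piW=> z.
by rewrite -!kp_pi_mul; apply/kp_piP/kpe_mulA.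
Qed.
Lemma kp_mulDl : left_distributive kp_mul +%R.
Proof.
elim/kp_piW=> x; elim/kp_piW=> y; elim/kp_piW=> z.
by rewrite -kp_piD -!kp_pi_mul -kp_piD; apply/kp_piP/kpe_mulDl.
Qed.
Lemma kp_mulDr : right_distributive kp_mul +%R.
Proof.
elim/kp_piW=> x; elim/kp_piW=> y; elim/kp_piW=> z.
by rewrite -kp_piD -!kp_pi_mul -kp_piD; apply/kp_piP/kpe_mulDr.
Qed.
Lemma kp_scaleAl c x y : kp_mul (c *: x) y = c *: kp_mul x y.
Proof.
elim/kp_piW: x => x; elim/kp_piW: y => y.
by rewrite -kp_piZ -!kp_pi_mul -kp_piZ; apply/kp_piP/kpe_scaleAl.
Qed.
Lemma kp_scaleAr c x y : kp_mul x (c *: y) = c *: kp_mul x y.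
Proof.
elim/kp_piW: x => x; elim/kp_piW: y => y.
by rewrite -kp_piZ -!kp_pi_mul -kp_piZ; apply/kp_piP/kpe_scaleAr.
Qed.

Lemma kp_mul0r x : kp_mul 0 x = 0.
Proof. by have := kp_scaleAl 0 0 x; rewrite !scale0r. Qed.
Lemma kp_mulr0 x : kp_mul x 0 = 0.
Proof. by have := kp_scaleAr 0 x 0; rewrite !scale0r. Qed.

Lemma kp_pi_sum (I : Type) (r : seq I) (F : I -> kp_term) :
  pi (\big[KPadd/KP0]_(i <- r) F i) = \sum_(i <- r) pi (F i).
Proof.
by elim: r => [|i r IH]; rewrite ?big_nil // !big_cons kp_piD IH.
Qed.

Lemma kp_alg_family : kp_family kp_mul kp_p kp_s kp_s'.
Proof.
split.
- by move=> v; split; apply/kp_piP; constructor.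
- move=> v w; rewrite -kp_pi_mul (kp_piP (kpe1 v w)).
  by case: (v == w).
- by move=> a b h; rewrite -!kp_pi_mul; split; apply/kp_piP; constructor.
- by move=> a; rewrite -!kp_pi_mul; split; apply/kp_piP; constructor.
- by move=> a; rewrite -!kp_pi_mul; split; apply/kp_piP; constructor.
- move=> a b h; rewrite -kp_pi_mul (kp_piP (kpe3 h)).
  by case: (a == b).
- move=> v n h; rewrite /kp_p (kp_piP (kpe4 v h)) kp_pi_sum.
  by apply: eq_bigr => a _; rewrite kp_pi_mul.
Qed.

(* The universal property defining the Kumjian-Pask algebra. *)
Lemma kp_alg_universal (B : lmodType R) (mul : B -> B -> B)
    (P : Obj L -> B) (S S' : Mor L -> B) :
  associative mul -> left_distributive mul +%R ->
  right_distributive mul +%R ->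
  (forall c x y, mul (c *: x) y = c *: mul x y) ->
  (forall c x y, mul x (c *: y) = c *: mul x y) ->
  kp_family mul P S S' ->
  let hom (phi : {linear kp_alg -> B}) :=
    [/\ {morph phi : x y / kp_mul x y >-> mul x y},
        forall v, phi (kp_p v) = P v, forall a, phi (kp_s a) = S a
      & forall a, phi (kp_s' a) = S' a] in
  exists2 phi, hom phi & forall psi, hom psi -> phi =1 psi.
Proof.
move=> mA mDl mDr mAl mAr [fid f1 f2 f2r f2s f3 f4] hom.
pose ev := fix ev (t : kp_term) : B := match t with
  | KPp v => P v | KPs a => S a | KPs' a => S' a | KP0 => 0
  | KPadd x y => ev x + ev y | KPscale c x => c *: ev x
  | KPmul x y => mul (ev x) (ev y) end.
have evP x y : kp_eq x y -> ev x = ev y.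
  elim=> {x y} //=.
  - by move=> x y z _ -> _ ->.
  - by move=> x x' y y' _ -> _ ->.
  - by move=> c x x' _ ->.
  - by move=> x x' y y' _ -> _ ->.
  - by move=> x y z; rewrite addrA.
  - by move=> x y; rewrite addrC.
  - by move=> x; rewrite add0r.
  - by move=> b c x; rewrite scalerA.
  - by move=> x; rewrite scale0r.
  - by move=> x; rewrite scale1r.
  - by move=> c x y; rewrite scalerDr.
  - by move=> b c x; rewrite scalerDl.
  - by move=> v; case: (fid v).
  - by move=> v; case: (fid v).
  - by move=> v w; rewrite f1; case: (v == w).
  - by move=> a b /f2[].
  - by move=> a b /f2[].
  - by move=> a; case: (f2r a).
  - by move=> a; case: (f2r a).
  - by move=> a; case: (f2s a).
  - by move=> a; case: (f2s a).
  - by move=> a b /f3 ->; case: (a == b).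
  - move=> v n /f4 ->; rewrite (big_morph ev (id1 := 0) (op1 := +%R)) //.
pose phi (x : kp_alg) : B := ev (repr x).
have phiE t : phi (pi t) = ev t by apply/evP/reprP.
have lphi : linear phi.
  move=> c; elim/kp_piW=> x; elim/kp_piW=> y.
  by rewrite -kp_piZ -kp_piD !phiE.
pose phiL : {linear kp_alg -> B} :=
  HB.pack phi (GRing.isLinear.Build R kp_alg B _ phi lphi).
exists phiL.
  split=> [|v|a|a]; rewrite /= ?phiE //.
  by elim/kp_piW=> x; elim/kp_piW=> y; rewrite -kp_pi_mul !phiE.
move=> psi [hm hp hs hs'].
elim/kp_piW=> t; rewrite [LHS]phiE.
elim: t => [v|a|a||x IHx y IHy|c x IHx|x IHx y IHy] /=.
- by rewrite -hp.
- by rewrite -hs.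
- by rewrite -hs'.
- by rewrite -[LHS](linear0 psi).
- by rewrite kp_piD IHx IHy -linearD.
- by rewrite kp_piZ IHx -linearZ.
- by rewrite kp_pi_mul hm IHx IHy.
Qed.

Definition KP (finL : finite_vertices L) : Type := kp_alg.

Context (finL : finite_vertices L).

HB.instance Definition _ := Choice.on (KP finL).
HB.instance Definition _ := GRing.Zmodule.on (KP finL).
HB.instance Definition _ := GRing.Lmodule.on (KP finL).

Definition kp_one : kp_alg := \sum_(v <- fset_set [set: Obj L]) kp_p v.

Let suml (F : Obj L -> kp_alg) x :
  kp_mul (\sum_(v <- fset_set [set: Obj L]) F v) x =
  \sum_(v <- fset_set [set: Obj L]) kp_mul (F v) x.
Proof.
apply: (big_morph (kp_mul^~ x)) => [y z|]; [exact: kp_mulDl|exact: kp_mul0r].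
Qed.
Let sumr (F : Obj L -> kp_alg) x :
  kp_mul x (\sum_(v <- fset_set [set: Obj L]) F v) =
  \sum_(v <- fset_set [set: Obj L]) kp_mul x (F v).
Proof.
apply: (big_morph (kp_mul x)) => [y z|]; [exact: kp_mulDr|exact: kp_mulr0].
Qed.

Let one_p v : kp_mul kp_one (kp_p v) = kp_p v.
Proof.
rewrite suml (big_fsetD1 v) /=; last by rewrite in_fset_set // inE.
rewrite (kpf1 kp_alg_family) eqxx big_seq big1 ?addr0 // => w.
by rewrite !inE (kpf1 kp_alg_family) => /andP[/negPf ->].
Qed.
Let p_one v : kp_mul (kp_p v) kp_one = kp_p v.
Proof.
rewrite sumr (big_fsetD1 v) /=; last by rewrite in_fset_set // inE.
rewrite (kpf1 kp_alg_family) eqxx big_seq big1 ?addr0 // => w.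
by rewrite !inE (kpf1 kp_alg_family) eq_sym => /andP[/negPf ->].
Qed.

Fact kp_mul1r : left_id kp_one kp_mul.
Proof.
elim/kp_piW; elim=> [v|a|a||x IHx y IHy|c x IHx|x IHx y IHy].
- exact: one_p.
- by rewrite -[pi _]/(kp_s a); case: (kpf2r kp_alg_family a) => <- _; rewrite kp_mulA one_p.
- by rewrite -[pi _]/(kp_s' a); case: (kpf2s kp_alg_family a) => <- _; rewrite kp_mulA one_p.
- exact: kp_mulr0.
- by rewrite kp_piD [LHS]kp_mulDr IHx IHy.
- by rewrite kp_piZ [LHS]kp_scaleAr IHx.
- by rewrite kp_pi_mul kp_mulA IHx.
Qed.
Fact kp_mulr1 : right_id kp_one kp_mul.
Proof.
elim/kp_piW; elim=> [v|a|a||x IHx y IHy|c x IHx|x IHx y IHy].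
- exact: p_one.
- by rewrite -[pi _]/(kp_s a); case: (kpf2r kp_alg_family a) => _ <-; rewrite -kp_mulA p_one.
- by rewrite -[pi _]/(kp_s' a); case: (kpf2s kp_alg_family a) => _ <-; rewrite -kp_mulA p_one.
- exact: kp_mul0r.
- by rewrite kp_piD [LHS]kp_mulDl IHx IHy.
- by rewrite kp_piZ [LHS]kp_scaleAl IHx.
- by rewrite kp_pi_mul -kp_mulA IHy.
Qed.

(* This ring may be trivial: it is when there are no vertices. *)
HB.instance Definition _ := GRing.Zmodule_isPzRing.Build (KP finL)
  kp_mulA kp_mul1r kp_mulr1 kp_mulDl kp_mulDr.

End KumjianPask.

Arguments KP R {k} L finL.

Section Kernel.
Context {k l : nat} (f : {additive natv k -> natv l}).

Definition posv j (z : intv j) : natv j := 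
  [ffun i => if z i is Posz n then n else 0%N].
Definition negv j (z : intv j) : natv j := posv (- z).
Definition toZ j (n : natv j) : intv j := [ffun i => (n i)%:Z].

(* The unique additive extension of [f]: see [fbar_toZ] and [fbar_additive]. *)
Definition fbar (z : intv k) : intv l := toZ (f (posv z)) - toZ (f (negv z)).

Let toZD j (m n : natv j) : toZ (m + n) = toZ m + toZ n.
Proof. by apply/ffunP=> i; rewrite !ffunE. Qed.

Let toZ_inj j : injective (@toZ j).
Proof.
by move=> m n /ffunP h; apply/ffunP=> i; move: (h i); rewrite !ffunE => -[]. Qed.

Lemma posvK j (z : intv j) : z = toZ (posv z) - toZ (negv z).
Proof.
apply/ffunP=> i; rewrite !ffunE.
by case: (z i) => [[|n]|n] /=; lia.
Qed.

Let fbarE m n : fbar (toZ m - toZ n) = toZ (f m) - toZ (f n).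
Proof.
rewrite /fbar; set z := toZ m - toZ n.
have e : posv z + n = m + negv z.
  apply: toZ_inj; rewrite !toZD; apply/ffunP=> i.
  by have /ffunP/(_ i) := posvK z; rewrite /z !ffunE; lia.
have /ffunP e2 := congr1 (@toZ l \o f) e.
apply/ffunP=> i; have := e2 i; rewrite /= !raddfD !toZD !ffunE; lia.
Qed.

Lemma fbar_toZ m : fbar (toZ m) = toZ (f m).
Proof.
have e j : toZ (0 : natv j) = 0 by apply/ffunP=> i; rewrite !ffunE.
by rewrite -[toZ m]subr0 -(e k) fbarE raddf0 e subr0.
Qed.

Lemma fbar_additive : zmod_morphism fbar.
Proof.
move=> y z; rewrite {1}(posvK y) {1}(posvK z).
have -> : toZ (posv y) - toZ (negv y) - (toZ (posv z) - toZ (negv z)) =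
    toZ (posv y + negv z) - toZ (negv y + posv z).
  by rewrite !toZD opprB opprD; apply/ffunP=> i; rewrite !ffunE; lia.
by rewrite fbarE /fbar !raddfD !toZD; apply/ffunP=> i; rewrite !ffunE; lia.
Qed.
HB.instance Definition _ :=
  GRing.isZmodMorphism.Build (intv k) (intv l) fbar fbar_additive.

Definition kerf_pred : {pred intv k} := [pred z | fbar z == 0].
Fact kerf_zmod_closed : zmod_closed kerf_pred.
Proof.
split; first by rewrite inE raddf0.
move=> x y; rewrite !inE => /eqP hx /eqP hy.
by rewrite fbar_additive hx hy subr0.
Qed.
HB.instance Definition _ :=
  GRing.isZmodClosed.Build (intv k) kerf_pred kerf_zmod_closed.

Definition kerf : Type := {z : intv k | z \in kerf_pred}.
HB.instance Definition _ := [isSub of kerf for (@sval _ _ : kerf -> intv k)].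
HB.instance Definition _ := [Choice of kerf by <:].
HB.instance Definition _ := [SubChoice_isSubZmodule of kerf by <:].

End Kernel.

(* Finitely supported functions with the convolution product: multinomials'
   product on [{malg K[H]}] requires a monoid without nontrivial units.
   [<< h >>] is the basis element u_h. *)
Section GroupAlgebra.
Context (K : comNzRingType) (H : zmodType).
Local Notation malgH := {malg K[H]}.

Implicit Types g : malgH.

Definition galg_mul (g1 g2 : malgH) : malgH :=
  \sum_(a <- msupp g1) \sum_(b <- msupp g2) << g1@_a * g2@_b *g a + b >>.
Definition galg_one : malgH := << 0 >>.

Let mulw (d1 d2 : {fset H}) g1 g2 :
  (msupp g1 `<=` d1)%fset -> (msupp g2 `<=` d2)%fset ->
  galg_mul g1 g2 =
  \sum_(a <- d1) \sum_(b <- d2) << g1@_a * g2@_b *g a + b >>.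
Proof.
move=> le_d1 le_d2; rewrite /galg_mul (big_fset_incl _ le_d1) /=.
  apply/eq_bigr=> a _; apply/big_fset_incl => // b _ /mcoeff_outdom ->.
  by rewrite mulr0 monalgU0.
move=> a _ /mcoeff_outdom g1a.
by rewrite big1 // => b _; rewrite g1a mul0r monalgU0.
Qed.

Let mulUU c1 c2 a b : galg_mul << c1 *g a >> << c2 *g b >> =
  << c1 * c2 *g a + b >>.
Proof. by rewrite (mulw msuppU_le msuppU_le) !big_seq_fset1 !mcoeffUU. Qed.

Fact galg_mulC : commutative galg_mul.
Proof.
move=> g1 g2; rewrite /galg_mul exchange_big; apply: eq_bigr => b _.
by apply: eq_bigr => a _; rewrite mulrC addrC.
Qed.

Fact galg_mulDl : left_distributive galg_mul +%R.
Proof.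
move=> g1 g2 g; have le := fsubset_refl (msupp g).
rewrite (mulw (msuppD_le g1 g2) le).
rewrite (mulw (fsubsetUl (msupp g1) (msupp g2)) le).
rewrite (mulw (fsubsetUr (msupp g1) (msupp g2)) le) -big_split /=; apply/eq_bigr=> a _.
rewrite -big_split /=; apply/eq_bigr=> b _.
by rewrite mcoeffD mulrDl monalgUD.
Qed.

Fact galg_mul1 : left_id galg_one galg_mul.
Proof.
move=> g; rewrite (mulw msuppU_le (fsubset_refl _)) big_seq_fset1.
rewrite [RHS]monalgE; apply/eq_bigr => b _.
by rewrite mcoeffUU mul1r add0r.
Qed.

Let mulDr : right_distributive galg_mul +%R.
Proof. by move=> g g1 g2; rewrite galg_mulC galg_mulDl !(galg_mulC g). Qed.
Let mul0 g : galg_mul 0 g = 0.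
Proof. by rewrite /galg_mul msupp0 big_seq_fset0. Qed.
Let suml (r : seq H) (F : H -> malgH) g :
  galg_mul (\sum_(a <- r) F a) g = \sum_(a <- r) galg_mul (F a) g.
Proof.
by apply: (big_morph (galg_mul^~ g)) => [x y|]; rewrite ?galg_mulDl ?mul0.
Qed.
Let sumr (r : seq H) (F : H -> malgH) g :
  galg_mul g (\sum_(a <- r) F a) = \sum_(a <- r) galg_mul g (F a).
Proof. by rewrite galg_mulC suml; apply: eq_bigr => a _; rewrite galg_mulC. Qed.

Let assoc_of_basis (m : malgH -> malgH -> malgH) :
  (forall (r : seq H) F g, m (\sum_(a <- r) F a) g = \sum_(a <- r) m (F a) g) ->
  (forall (r : seq H) F g, m g (\sum_(a <- r) F a) = \sum_(a <- r) m g (F a)) ->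
  (forall c1 c2 a b, m << c1 *g a >> << c2 *g b >> = << c1 * c2 *g a + b >>) ->
  associative m.
Proof.
move=> ml mr mU g1 g2 g3; rewrite (monalgE g1) (monalgE g2) (monalgE g3).
rewrite !ml; apply: eq_bigr => a _.
rewrite mr [m << _ *g a >> (\sum_(j <- msupp g2) _)]mr ml.
apply: eq_bigr => b _; rewrite mU !mr; apply: eq_bigr => c _.
by rewrite !mU mulrA addrA.
Qed.

Fact galg_mulA : associative galg_mul.
Proof. exact: assoc_of_basis suml sumr mulUU. Qed.

Fact galg_one_neq0 : galg_one != 0.
Proof. by apply/eqP/malgP=> /(_ 0) /eqP; rewrite !mcoeffsE oner_eq0. Qed.

Definition galg : Type := malgH.
HB.instance Definition _ := GRing.Lmodule.on galg.
HB.instance Definition _ := GRing.Zmodule_isComNzRing.Build galg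
  galg_mulA galg_mulC galg_mul1 galg_mulDl galg_one_neq0.

End GroupAlgebra.

Section Ideals.
Context {R : pzRingType}.

Definition ideal (I : set R) : Prop :=
  [/\ I 0, forall x y, I x -> I y -> I (x + y)
    & forall a x, I x -> I (a * x) /\ I (x * a)].

Definition ideal_gen (S : set R) : set R :=
  [set x | forall I, ideal I -> S `<=` I -> I x].

Lemma ideal_gen_ideal S : ideal (ideal_gen S).
Proof.
split=> [I [] //|x y hx hy I hI SI|a x hx].
  by case: (hI) => _ + _; apply; [apply: hx | apply: hy].
by split=> I hI SI; case: (hI) => _ _ h; case: (h a x (hx I hI SI)).
Qed.

Lemma sub_ideal_gen S : S `<=` ideal_gen S.
Proof. by move=> x Sx I _; apply. Qed.

Definition maximal_ideal : set (set R) :=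
  [set m | [/\ ideal m, m <> setT &
    forall J, ideal J -> m `<=` J -> J = m \/ J = setT]].

Definition submodule (M : lmodType R) (N : set M) : Prop :=
  [/\ N 0, forall x y, N x -> N y -> N (x + y)
    & forall a x, N x -> N (a *: x)].

Definition simple_module (M : lmodType R) : Prop :=
  (exists x : M, x <> 0) /\
  forall N : set M, submodule N -> N = [set 0] \/ N = setT.

Definition annihilator (M : lmodType R) : set R :=
  [set a | forall x : M, a *: x = 0].

Definition primitive_ideal : set (set R) :=
  [set P | exists M : lmodType R, simple_module M /\ P = annihilator M].

Definition prime_ideal (P : set R) : Prop :=
  [/\ ideal P, P <> setT & forall I J, ideal I -> ideal J ->
    I `&` J `<=` P -> I `<=` P \/ J `<=` P].

Lemma maximal_ideal_prime m : maximal_ideal m -> prime_ideal m.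
Proof.
move=> [im pm mm]; split=> // I J iI iJ IJm.
have [? | /existsNP [i /not_implyP[Ii mi]]] := pselect (I `<=` m); first by left.
have [? | /existsNP [j /not_implyP[Jj mj]]] := pselect (J `<=` m); first by right.
exfalso; apply: pm.
have dec X : ideal X -> (exists2 z, X z & ~ m z) ->
    exists2 x, X x & m (1 - x).
  move=> iX [z Xz mz].
  pose Y := [set y | exists2 x, X x & m (y - x)].
  have iY : ideal Y.
    case: im iX => m0 mD mM [X0 XD XM]; split.
    - by exists 0; rewrite ?subr0.
    - move=> x y [x' hx hx'] [y' hy hy']; exists (x' + y'); first exact: XD.
      by rewrite opprD addrACA; apply: mD.
    - move=> a x [x' hx hx']; split.
        by exists (a * x'); [case: (XM a _ hx) | rewrite -mulrBr; case: (mM a _ hx')].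
      by exists (x' * a); [case: (XM a _ hx) | rewrite -mulrBl; case: (mM a _ hx')].
  have mY : m `<=` Y.
    by move=> x mx; exists 0; [case: iX | rewrite subr0].
  have [e|e] := mm Y iY mY.
  - by case: mz; rewrite -e; exists z => //; rewrite subrr; case: im.
  - by have : Y 1 by rewrite e.
have [x Ix mx] := dec I iI (ex_intro2 _ _ i Ii mi).
have [y Jy my] := dec J iJ (ex_intro2 _ _ j Jj mj).
have mxy : m (x * y).
  apply: IJm; split; first by case: iI => _ _ /(_ y x Ix)[].
  by case: iJ => _ _ /(_ x y Jy)[].
have m1 : m 1.
  case: im => m0 mD mM.
  have -> : 1 = (1 - x) + (x * (1 - y) + x * y).
    by rewrite -mulrDr subrK mulr1 subrK.
  by apply: (mD) => //; apply: (mD) => //; case: (mM x _ my).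
apply/seteqP; split=> // z _; case: im => _ _ /(_ z 1 m1)[+ _].
by rewrite mulr1.
Qed.

Lemma primitive_ideal_prime P : primitive_ideal P -> prime_ideal P.
Proof.
move=> [M [[[x0 nx0] sM] ->]]; split.
- split=> [x|a b ha hb x|a b hb]; first by rewrite scale0r.
    by rewrite scalerDl ha hb addr0.
  by split=> x; rewrite -scalerA hb ?scaler0.
- move=> e; apply: nx0.
  have : annihilator M 1 by rewrite e.
  by move/(_ x0); rewrite scale1r.
- move=> I J [I0 ID IM] [J0 JD JM] IJP.
  have [|/existsNP[j /not_implyP[Jj /existsNP[x jx]]]] :=
    pselect (J `<=` annihilator M); first by right.
  left=> i Ii y.
  pose N := [set z : M | forall a, I a -> a *: z = 0].
  have sN : submodule N.
    split=> [a _|u v hu hv a Ia|a u hu b Ib]; first by rewrite scaler0.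
      by rewrite scalerDr hu // hv // addr0.
    by rewrite scalerA hu //; case: (IM a b Ib).
  have Njx : N (j *: x).
    move=> a Ia; rewrite scalerA; apply: IJP.
    by split; [case: (IM j a Ia) | case: (JM a j Jj)].
  have [e|e] := sM N sN; first by move: Njx; rewrite e => /jx.
  have : N y by rewrite e.
  exact.
Qed.

(* The closed sets of the hull-kernel topology on a set [X] of ideals. *)
Definition hull (X : set (set R)) (I : set R) : set X :=
  [set P | I `<=` val P].

Definition hk_open (X : set (set R)) (U : set X) : Prop :=
  exists2 I, ideal I & U = ~` hull I.

Section HullKernel.
Context (X : set (set R)) (primeX : X `<=` prime_ideal).

Lemma hk_openT : hk_open [set: X].
Proof.
exists setT => //; apply/seteqP; split=> // P _ /= h.
have [_ pP _] := primeX (set_mem (valP P)).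
by apply: pP; apply/seteqP; split.
Qed.

Lemma hk_openI : setI_closed (@hk_open X).
Proof.
move=> _ _ [I iI ->] [J iJ ->]; exists (I `&` J).
  case: iI iJ => I0 ID IM [J0 JD JM]; split=> //.
    by move=> x y [? ?] [? ?]; split; [apply: ID | apply: JD].
  move=> a x [Ix Jx]; have [? ?] := IM a x Ix; have [? ?] := JM a x Jx.
  by split; split.
rewrite -setCU; congr (~` _); apply/seteqP; split=> [P|P] /=.
  by case=> h x [Ix Jx]; apply: h.
have [_ _ pP] := primeX (set_mem (valP P)).
by move=> h; apply: pP.
Qed.

Lemma hk_open_bigU (Y : Type) (F : Y -> set X) :
  (forall y, hk_open (F y)) -> hk_open (\bigcup_y F y).
Proof.
move=> oF; have /choice[J hJ] : forall y, exists J, ideal J /\ F y = ~` hull J.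
  by move=> y; have [J] := oF y; exists J.
exists (ideal_gen (\bigcup_y J y)); first exact: ideal_gen_ideal.
apply/seteqP; split=> P /=.
  move=> [y _]; have [iJ ->] := hJ y => /= h1 h2; apply: h1 => x Jx.
  by apply: h2; apply: sub_ideal_gen; exists y.
move=> h; apply: contrapT => h2; apply: h => x; apply.
  by have [] := primeX (set_mem (valP P)).
move=> z [y _ Jz]; apply: contrapT => Pz; apply: h2; exists y => //.
by have [_ ->] := hJ y => /=; move/(_ z Jz).
Qed.

End HullKernel.
End Ideals.

Definition Prim (A : pzRingType) : Type := set_type (@primitive_ideal A).
HB.instance Definition _ (A : pzRingType) := Choice.on (Prim A).
HB.instance Definition _ (A : pzRingType) :=
  isOpenTopological.Build (Prim A)
    (hk_openT (@primitive_ideal_prime A)) (hk_openI (@primitive_ideal_prime A))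
    (hk_open_bigU (@primitive_ideal_prime A)).

Definition MaxSpec (C : comPzRingType) : Type := set_type (@maximal_ideal C).
HB.instance Definition _ (C : comPzRingType) := Choice.on (MaxSpec C).
HB.instance Definition _ (C : comPzRingType) :=
  isOpenTopological.Build (MaxSpec C)
    (hk_openT (@maximal_ideal_prime C)) (hk_openI (@maximal_ideal_prime C))
    (hk_open_bigU (@maximal_ideal_prime C)).

Section MaximalTails.
Context (l : nat) (G : kgraph l).

Definition MT : Type := set_type (@maximal_tail l G).

Definition MT_basis (v : Obj G) : set MT := [set T | val T v].

(* Unions of basic sets. *)
Definition MT_open (U : set MT) : Prop :=
  forall T, U T -> exists2 v, MT_basis v T & MT_basis v `<=` U.

Fact MT_openT : MT_open setT.
Proof. by move=> T _; have [[v Tv] _ _ _] := set_mem (valP T); exists v. Qed.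

Fact MT_openI : setI_closed MT_open.
Proof.
move=> U V oU oV T [/oU[v Tv vU] /oV[w Tw wV]].
have [_ _ _ mt3] := set_mem (valP T).
have [z [Tz vz wz]] := mt3 v w Tv Tw.
exists z => // S Sz; have [_ mt1 _ _] := set_mem (valP S).
by split; [apply: vU; apply: mt1 vz | apply: wV; apply: mt1 wz].
Qed.

Fact MT_open_bigU (I : Type) (F : I -> set MT) :
  (forall i, MT_open (F i)) -> MT_open (\bigcup_i F i).
Proof.
move=> oF T [i _ /(oF i)[v Tv vF]]; exists v => // S /vF FS.
by exists i.
Qed.

HB.instance Definition _ := Choice.on MT.
HB.instance Definition _ :=
  isOpenTopological.Build MT MT_openT MT_openI MT_open_bigU.

End MaximalTails.

Definition homeomorphism (X Y : topologicalType) (phi : X -> Y) : Prop :=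
  continuous phi /\
  exists psi : Y -> X, [/\ cancel phi psi, cancel psi phi & continuous psi].

(* [range phi] carries the subspace topology. *)
Definition corestrict (X : Type) (Y : topologicalType) (phi : X -> Y) (x : X) :
  range phi := exist _ (phi x) (mem_set (imageT phi x)).

Definition homeomorphism_onto_image (X Y : topologicalType) (phi : X -> Y) :=
  homeomorphism (corestrict phi).

Section PrimitiveIdeals.
Context (K : fieldType) (k l : nat) (f : {additive natv k -> natv l}).
Context (G : kgraph l) (finG : finite_vertices G).

Local Notation A := (KP K (pullback f G) finG).
Local Notation C := (galg K (kerf f)).

Definition pb_p (v : Obj G) : A := kp_p K (L := pullback f G) v.

(* s_{(a, n)} and s_{(a, n)^*}, with value 0 if deg a <> f n. *)
Definition pb_s (a : Mor G) (n : natv k) : A :=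
  oapp (kp_s K (L := pullback f G)) 0 (pb_path f a n).
Definition pb_s' (a : Mor G) (n : natv k) : A :=
  oapp (kp_s' K (L := pullback f G)) 0 (pb_path f a n).

Definition pb_U (h : kerf f) : A :=
  \sum_(v <- fset_set [set: Obj G])
    \sum_(a <- fset_set (vpaths v (f (posv (val h)))))
      pb_s a (posv (val h)) * pb_s' a (negv (val h)).

Definition iota (c : C) : A := \sum_(h <- msupp c) c@_h *: pb_U h.

(* I_{H_T} *)
Definition vertex_ideal (T : MT G) : set A :=
  ideal_gen [set pb_p v | v in ~` val T].

(* A iota(m): the finite sums of products x * iota c with c in m. *)
Definition extended_ideal (m : set C) : set A :=
  [set x | exists2 s : seq (A * C),
     (forall xc, xc \in s -> m xc.2) & x = \sum_(xc <- s) xc.1 * iota xc.2].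

Definition P_ideal (T : MT G) (m : MaxSpec C) : set A :=
  [set x + y | x in vertex_ideal T & y in extended_ideal (val m)].

End PrimitiveIdeals.

Arguments P_ideal K {k l} f {G} finG T m.

(* Main.v *)
From HB Require Import structures.
From mathcomp Require Import all_boot all_algebra finmap.
From mathcomp Require Import boolp classical_sets functions cardinality.
From mathcomp Require Import topology.
From mathcomp Require Import monalg.
Require Import Defs.

Set Implicit Arguments.
Unset Strict Implicit.
Unset Printing Implicit Defensive.

Import GRing.Theory.

Local Open Scope classical_set_scope.
Local Open Scope ring_scope.

(** The algebra [A] is treated as an algebra over its central subalgebra
  [iota C].  As [f] is onto, it has an additive section [g]; the elements
  [gam a = s_(a, g (deg a))] form a Kumjian-Pask family of [G] in [A], and
  [s_(a, n)] is [gam a] times a central unit [U_h].  So [A] behaves like the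
  Kumjian-Pask algebra of [G] with coefficients in [C], and two facts decide
  everything about the ideals [P(T, m)], called [tail_ideal T m] below.

  Upper bound ([tail_uniqueness]): if [x] is not in [P(T, m)], then the ideal
  generated by [x] contains [p_v iota(c)] for some [v] in [T] and some [c]
  outside [m].  Multiplying [x] by a long path makes it a combination of paths
  with a common source in [T]; compressing by initial segments of an aperiodic
  path of the tail isolates one term.

  Lower bound ([tail_ideal_p_iota]): no such product is in [P(T, m)].  The
  paths of [G] act on the [C]-valued functions of paths by adding and removing
  initial segments, and the relations hold modulo the functions that take
  values in [m] at all long paths ending in [T].

  Hence [p_v iota(c)] is in [P(T, m)] exactly when [v] is not in [T] or [c] is
  in [m], so that the basic open set of the points [(T, m)] with [v] in [T] and
  [c] outside [m] corresponds to the open set of the primitive ideals that miss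
  [p_v iota(c)]: this is the homeomorphism onto the image.

  Primitivity: as [T] is finite, it has a vertex [z] reached from all of [T];
  the idempotent [p_z] is not in [P(T, m)], so it acts nontrivially on a simple
  module killed by [P(T, m)], whose annihilator cannot be larger by the upper
  bound.

  Surjectivity: over an uncountable algebraically closed field, [A] has
  countable dimension, so [iota C] acts on a simple module by scalars
  ([central_character]), through a maximal ideal [m]; the vertices that do not
  kill the module form a maximal tail [T], and the upper bound shows that the
  annihilator is no larger than [P(T, m)].  The closure of a point consists of
  the primitive ideals that contain it, and [P(T, m)] is contained in [P(S, n)]
  exactly when [S] is contained in [T] and [m = n]. *)

(** * Paths in a k-graph *)

Section Degrees.
Context {k : nat}.
Implicit Types p q r : natv k.

Lemma lev_addr p q : lev p (p + q).
Proof. by apply/forallP=> i; rewrite ffunE leq_addr. Qed.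

Lemma lev_addl p q : lev p (q + p).
Proof. by rewrite addrC lev_addr. Qed.

Lemma levE p q : lev p q -> exists r, q = p + r.
Proof.
move=> /forallP h; exists (subv q p); apply/ffunP=> i; rewrite !ffunE.
by rewrite [RHS]subnKC.
Qed.

Lemma lev_refl p : lev p p.
Proof. by apply/forallP. Qed.

Lemma lev_trans p q r : lev p q -> lev q r -> lev p r.
Proof.
by move=> /forallP h /forallP g; apply/forallP=> i; apply: leq_trans (g i).
Qed.

Lemma lev0 p : lev 0 p.
Proof. by apply/forallP=> i; rewrite ffunE. Qed.

Lemma addvI p : injective (+%R p).
Proof.
by move=> q r /ffunP h; apply/ffunP=> i; have := h i; rewrite !ffunE => /addnI.
Qed.

Lemma subvDl p q : subv (p + q) p = q.
Proof. by apply/ffunP=> i; rewrite !ffunE addKn. Qed.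

Lemma subv0 p : subv p 0 = p.
Proof. by rewrite -{1}[p]add0r subvDl. Qed.

Lemma levD2r p q r : lev (q + p) (r + p) = lev q r.
Proof. by apply: eq_forallb => i; rewrite !ffunE leq_add2r. Qed.

Lemma levD2l p q r : lev (p + q) (p + r) = lev q r.
Proof. by rewrite ![p + _]addrC levD2r. Qed.

End Degrees.

Section Paths.
Context {k : nat} (G : kgraph k).
Implicit Types (a b c : Mor G) (v w : Obj G) (n : natv k).

Lemma factor_uniq a b a' b' : src a = rng b -> src a' = rng b' ->
  comp a b = comp a' b' -> deg a = deg a' -> a = a' /\ b = b'.
Proof.
move=> h h' e ed.
have [[x y] [_ u]] := factor (deg_comp h).
have e2 : deg b = deg b'.
  by apply: (@addvI _ (deg a)); rewrite -deg_comp // e deg_comp // ed.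
have [ex ey] : (x, y) = (a, b) by apply: u; split.
have [<- <-] : (x, y) = (a', b') by apply: u; split.
by rewrite ex ey.
Qed.

Lemma factor_ex a n : lev n (deg a) ->
  exists b c, [/\ src b = rng c, a = comp b c & deg b = n].
Proof.
by move=> /levE[r /factor[[b c] [[/= h e <- _] _]]]; exists b, c.
Qed.

Lemma deg0_idm a : deg a = 0 -> a = idm (rng a).
Proof.
move=> d0.
have e : comp (idm (rng a)) a = comp a (idm (src a)).
  by rewrite comp_idl comp_idr.
have [] // := factor_uniq _ _ e.
- by rewrite src_id.
- by rewrite rng_id.
- by rewrite deg_id d0.
Qed.

(** The path [c] with [mu = comp a c], when there is one: the inverse of the
  injection of the paths leaving [src a] that prolongs them by [a]. *)
Definition strip a mu : option (Mor G) :=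
  if pselect (exists c, src a = rng c /\ mu = comp a c) is left h
  then Some (sval (cid h)) else None.

Lemma strip_comp a c : src a = rng c -> strip a (comp a c) = Some c.
Proof.
move=> h; rewrite /strip; case: pselect => [h'|[]]; last by exists c.
by case: cid => c' /= [h1 h2]; case: (factor_uniq h h1 h2 erefl) => _ ->.
Qed.

Lemma stripP a mu :
  (exists2 c, src a = rng c & mu = comp a c /\ strip a mu = Some c) \/
  (forall c, src a = rng c -> mu <> comp a c) /\ strip a mu = None.
Proof.
rewrite /strip; case: pselect => [h|h].
  by left; case: cid => c [h1 h2] /=; exists c.
by right; split=> // c h1 h2; apply: h; exists c.
Qed.

Lemma strip_none a mu : (forall c, src a = rng c -> mu <> comp a c) ->
  strip a mu = None.
Proof. by move=> h; have [[c hc [e _]]|[_ //]] := stripP a mu; case: (h c). Qed.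

Lemma reach_trans u v w : @reach _ G u v -> reach v w -> reach u w.
Proof.
move=> [a [ra sa]] [b [rb sb]]; exists (comp a b).
by rewrite rng_comp ?src_comp // sa rb.
Qed.

End Paths.

Section Aperiodicity.
Context {k : nat} (G : kgraph k).
Implicit Types (a b c : Mor G) (n : natv k) (x : natv k -> natv k -> Mor G).

Lemma path_rng0 x q : infinite_path x -> rng (x 0 q) = rng (x 0 0).
Proof. by move=> [_ _ h _]; have [] := h 0 q (lev0 q). Qed.

(** Initial segments determine a path, so two distinct shifts of [x] already
  differ on an initial segment. *)
Lemma shift_neq_segment x m n : infinite_path x ->
  ~ eq_path (shift m x) (shift n x) -> exists q, x m (q + m) <> x n (q + n).
Proof.
move=> [xd _ xrs xc] ne; apply: contrapT => /forallNP h; apply: ne => p q pq.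
have e r : x m (r + m) = x n (r + n) by apply: contrapT (h r).
have pqm s : lev (p + s) (q + s) by rewrite levD2r.
have := e q; rewrite /shift.
rewrite (xc m (p + m) (q + m)) ?lev_addl // (xc n (p + n) (q + n)) ?lev_addl // (e p).
move/factor_uniq; case=> //.
  by rewrite -e (xrs _ _ (lev_addl _ _)).2 (xrs _ _ (pqm _)).1.
by rewrite (xrs _ _ (lev_addl _ _)).2 (xrs _ _ (pqm _)).1.
Qed.

(** If [a] and [b] have different degrees [m] and [n], prolonging them by a
  long segment of [x] separates them: a common prolongation of [a x(0,q)] and
  [b x(0,q)] contains, between the degrees [m + n] and [m + n + p], both
  [x(n, n + p)] and [x(m, m + p)]. *)
Lemma aperiodic_separates x a b : infinite_path x ->
  src a = rng (x 0 0) -> src b = rng (x 0 0) ->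
  ~ eq_path (shift (deg a) x) (shift (deg b) x) ->
  exists q0, forall q c d, lev q0 q -> src (x 0 q) = rng c ->
    src (x 0 q) = rng d -> comp a (comp (x 0 q) c) <> comp b (comp (x 0 q) d).
Proof.
move=> ix sa sb /(shift_neq_segment ix)[p np]; set m := deg a; set n := deg b.
exists (p + m + n) => q c d lq rc rd e; apply: np; rewrite -/m -/n.
have [xd _ xrs xc] := ix.
have lq1 : lev (p + n) q.
  by apply: lev_trans lq; rewrite -addrA addrCA [m + _]addrC lev_addr.
have lq2 : lev (p + m) q by apply: lev_trans lq; rewrite lev_addr.
have ln s : lev s (p + s) := lev_addl s p.
have seg s (y z : Mor G) : lev (p + s) q -> src y = rng (x 0 0) ->
    src (x 0 q) = rng z ->
    let w := comp (x (p + s) q) z in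
    comp y (comp (x 0 q) z) = comp (comp y (x 0 s)) (comp (x s (p + s)) w) /\
    [/\ src y = rng (x 0 s), src (comp y (x 0 s)) = rng (comp (x s (p + s)) w) &
        src (x s (p + s)) = rng w].
  move=> ls sy rz w.
  have h1 : src (x 0 s) = rng (x s (p + s)).
    by rewrite (xrs _ _ (lev0 s)).2 (xrs _ _ (ln s)).1.
  have h2 : src (x s (p + s)) = rng (x (p + s) q).
    by rewrite (xrs _ _ (ln s)).2 (xrs _ _ ls).1.
  have h3 : src (x (p + s) q) = rng z.
    by rewrite (xrs _ _ ls).2 -(xrs _ _ (lev0 q)).2.
  have h4 : src y = rng (x 0 s) by rewrite path_rng0.
  split; last by split; rewrite // ?src_comp // ?rng_comp ?h2 // rng_comp.
  have sq : lev s q by apply: lev_trans ls.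
  rewrite (xc 0 s q) ?lev0 // (xc s (p + s) q) //.
  have h5 : src (comp (x s (p + s)) (x (p + s) q)) = rng z by rewrite src_comp.
  have h6 : src (x 0 s) = rng (comp (x s (p + s)) (x (p + s) q)).
    by rewrite rng_comp.
  rewrite -(comp_assoc h6 h5) -(comp_assoc h2 h3) comp_assoc //.
  by rewrite rng_comp // rng_comp.
have [ea [ha1 ha2 ha3]] := seg n a c lq1 sa rc.
have [eb [hb1 hb2 hb3]] := seg m b d lq2 sb rd.
have [|_ e2] := factor_uniq ha2 hb2 (etrans (esym ea) (etrans e eb)).
  by rewrite !deg_comp // !xd ?lev0 // !subv0 addrC.
have [|-> //] := factor_uniq ha3 hb3 e2.
by rewrite !xd // -/m -/n ![p + _]addrC !subvDl.
Qed.

(** An infinite path of [G \ L] is an infinite path of [G] whose vertices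
  avoid [L]. *)
Lemma aperiodic_path_remove (L : set (Obj G)) (herL : hereditary L) v :
  aperiodic (remove herL) -> ~ L v ->
  exists x, [/\ infinite_path x, rng (x 0 0) = v,
    forall p q, ~ L (src (x p q)) &
    forall m n, m <> n -> ~ eq_path (shift m x) (shift n x)].
Proof.
move=> ap nLv.
have [y [[yd yid yrs yc] y0 yap]] := ap (exist _ v (mem_set nLv)).
exists (fun p q => val (y p q)); split.
- split=> [p q|p|p q pq|p q t pq qt]; first exact: yd.
  + by rewrite {1}yid.
  + by case: (yrs p q pq) => /(congr1 val) /= -> /(congr1 val).
  + rewrite (yc _ _ _ pq qt) /= val_insubd.
    have h : src (val (y p q)) = rng (val (y q t)).
      case: (yrs p q pq) => _ /(congr1 val) /= ->.
      by case: (yrs q t qt) => /(congr1 val) /= ->.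
    by rewrite src_comp //; case: (y q t) => z /= ->.
- by rewrite -[v]/(val (exist (fun v => v \in ~` L) v (mem_set nLv))) -y0.
- by move=> p q; case: (y p q) => z /= /set_mem.
- move=> m n /yap ne e; apply: ne => p q pq; apply: val_inj.
  exact: e.
Qed.

End Aperiodicity.

(** * The relations of the pullback algebra *)

Section FiniteSums.

Lemma sum_if_eq (V : nmodType) (I : eqType) (r : seq I) (F : I -> V) i :
  uniq r -> \sum_(j <- r) (if j == i then F j else 0) =
            if i \in r then F i else 0.
Proof.
move=> ur; case: ifP => [ir|/negbT ir]; last first.
  rewrite big_seq big1 // => j jr; case: eqP => // e.
  by move: ir; rewrite -e jr.
by rewrite (bigD1_seq i) //= eqxx big1 ?addr0 // => j /negPf ->.
Qed.

End FiniteSums.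

Section Relations.
Context (K : fieldType) (k l : nat) (f : {additive natv k -> natv l}).
Context (G : kgraph l) (rfG : row_finite G) (finG : finite_vertices G).

Local Notation Lam := (pullback f G).
Local Notation A := (KP K Lam finG).
Local Notation p := (pb_p K f finG).
Local Notation s := (pb_s K f finG).
Local Notation s' := (pb_s' K f finG).

Implicit Types (a b c : Mor G) (v w : Obj G) (n m : natv k).

Definition pb_mor a n (h : deg a = f n) : Mor Lam :=
  exist (fun an : Mor G * natv k => deg an.1 == f an.2) (a, n) (introT eqP h).

Lemma pb_morP (x : Mor Lam) : exists a n (h : deg a = f n), x = pb_mor h.
Proof.
case: x => -[a n] h; exists a, n, (eqP h).
by apply: val_inj.
Qed.

Lemma pb_path_mor a n (h : deg a = f n) : pb_path f a n = Some (pb_mor h).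
Proof.
rewrite /pb_path; case: insubP => [u _ eu|]; last by rewrite /= h eqxx.
by congr Some; apply: val_inj.
Qed.

Lemma pb_sE a n (h : deg a = f n) : s a n = kp_s K (pb_mor h).
Proof. by rewrite /pb_s (pb_path_mor h). Qed.

Lemma pb_s'E a n (h : deg a = f n) : s' a n = kp_s' K (pb_mor h).
Proof. by rewrite /pb_s' (pb_path_mor h). Qed.

Lemma pb_s_out a n : deg a <> f n -> s a n = 0 /\ s' a n = 0.
Proof. by move=> /eqP h; rewrite /pb_s /pb_s' /pb_path insubN. Qed.

Let fam := kp_alg_family K Lam.

Lemma comp_pb_mor a b n m (ha : deg a = f n) (hb : deg b = f m)
    (hab : deg (comp a b) = f (n + m)) : src a = rng b ->
  comp (pb_mor ha) (pb_mor hb) = pb_mor hab.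
Proof. by move=> h; apply: val_inj; rewrite /= val_insubd /= hab eqxx. Qed.

Lemma pb_deg_comp2 a b n m : deg a = f n -> deg b = f m -> src a = rng b ->
  deg (comp a b) = f (n + m).
Proof. by move=> ha hb h; rewrite deg_comp // ha hb raddfD. Qed.

Lemma pb_sM a b n m : deg a = f n -> deg b = f m -> src a = rng b ->
  s a n * s b m = s (comp a b) (n + m).
Proof.
move=> ha hb h; have hab := pb_deg_comp2 ha hb h.
rewrite (pb_sE ha) (pb_sE hb) (pb_sE hab) -(comp_pb_mor ha hb hab h).
exact: (kpf2 fam (a := pb_mor ha) (b := pb_mor hb) h).1.
Qed.

Lemma pb_s'M a b n m : deg a = f n -> deg b = f m -> src a = rng b ->
  s' b m * s' a n = s' (comp a b) (n + m).
Proof.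
move=> ha hb h; have hab := pb_deg_comp2 ha hb h.
rewrite (pb_s'E ha) (pb_s'E hb) (pb_s'E hab) -(comp_pb_mor ha hb hab h).
exact: (kpf2 fam (a := pb_mor ha) (b := pb_mor hb) h).2.
Qed.

Lemma pb_pM v w : p v * p w = if v == w then p v else 0.
Proof. exact: (kpf1 fam). Qed.

Lemma pb_s_idm v : s (idm v) 0 = p v /\ s' (idm v) 0 = p v.
Proof.
have h : deg (idm v) = f 0 by rewrite deg_id raddf0.
rewrite (pb_sE h) (pb_s'E h).
have -> : pb_mor h = idm (v : Obj Lam) by apply: val_inj.
exact: (kpf_id fam).
Qed.

Lemma pb_s'Ms a b n : deg a = f n -> deg b = f n ->
  s' a n * s b n = if a == b then p (src a) else 0.
Proof.
move=> ha hb; rewrite (pb_s'E ha) (pb_sE hb).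
rewrite [LHS](kpf3 fam (a := pb_mor ha) (b := pb_mor hb) erefl).
by rewrite -val_eqE /= xpair_eqE eqxx andbT.
Qed.

Let delta v w (x : A) :
  p w * x = x -> p v * x = if w == v then x else 0.
Proof. by move=> <-; rewrite mulrA pb_pM eq_sym; case: eqP => [->|_]; rewrite ?mul0r. Qed.
Let delta' v w (x : A) :
  x * p w = x -> x * p v = if w == v then x else 0.
Proof. by move=> <-; rewrite -mulrA pb_pM; case: eqP => [->|_]; rewrite ?mulr0. Qed.

Lemma pb_pMs v a n : p v * s a n = if rng a == v then s a n else 0.
Proof.
have [h|/eqP/pb_s_out[-> _]] := eqVneq (deg a) (f n); last by rewrite mulr0 if_same.
by apply: delta; rewrite (pb_sE h); apply: (kpf2r fam (pb_mor h)).1.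
Qed.

Lemma pb_sMp v a n : s a n * p v = if src a == v then s a n else 0.
Proof.
have [h|/eqP/pb_s_out[-> _]] := eqVneq (deg a) (f n); last by rewrite mul0r if_same.
by apply: delta'; rewrite (pb_sE h); apply: (kpf2r fam (pb_mor h)).2.
Qed.

Lemma pb_pMs' v a n : p v * s' a n = if src a == v then s' a n else 0.
Proof.
have [h|/eqP/pb_s_out[_ ->]] := eqVneq (deg a) (f n); last by rewrite mulr0 if_same.
by apply: delta; rewrite (pb_s'E h); apply: (kpf2s fam (pb_mor h)).1.
Qed.

Lemma pb_s'Mp v a n : s' a n * p v = if rng a == v then s' a n else 0.
Proof.
have [h|/eqP/pb_s_out[_ ->]] := eqVneq (deg a) (f n); last by rewrite mul0r if_same.
by apply: delta'; rewrite (pb_s'E h); apply: (kpf2s fam (pb_mor h)).2.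
Qed.

Lemma pb_sM0 a b n m : src a <> rng b -> s a n * s b m = 0.
Proof.
move=> h; have {1}-> : s a n = s a n * p (src a) by rewrite pb_sMp eqxx.
by rewrite -mulrA pb_pMs eq_sym; case: eqP => [/h|_] //; rewrite mulr0.
Qed.

Definition paths_of_deg (d : natv l) : {fset Mor G} :=
  fset_set [set a | deg a = d].

Lemma paths_of_deg_finite d : finite_set [set a : Mor G | deg a = d].
Proof.
apply: (sub_finite_set (B := \bigcup_(v in [set: Obj G]) vpaths v d)).
  by move=> a da; exists (rng a).
by apply: bigcup_finite => // v _; apply: rfG.
Qed.

Lemma in_paths_of_deg d a : (a \in paths_of_deg d) = (deg a == d).
Proof.
rewrite in_fset_set; last exact: paths_of_deg_finite.
by apply/idP/eqP; rewrite inE.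
Qed.

Lemma pb_vpaths_finite v n : finite_set (vpaths (v : Obj Lam) n).
Proof.
pose B := vpaths v (f n) `*` [set n].
apply: (sub_finite_set (B := (fun x : Mor Lam => val x) @^-1` B)).
  move=> x [rx dx]; split => //; split=> //.
  by case: x rx dx => -[a m] /= /eqP am _ dx; rewrite am -[m]/(m) -dx.
apply: finite_preimage; first by move=> x y _ _; apply: val_inj.
by apply: finite_setX => //; apply: rfG.
Qed.

Lemma in_pb_vpaths v n x :
  (x \in fset_set (vpaths (v : Obj Lam) n)) = (rng x == v) && (deg x == n).
Proof.
rewrite in_fset_set; last exact: pb_vpaths_finite.
by apply/idP/andP => [/set_mem[-> ->] //|[/eqP ? /eqP ?]]; apply/mem_set.
Qed.

Lemma pb_p_sum v n : p v = \sum_(x <- fset_set (vpaths (v : Obj Lam) n))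
  (kp_s K x : A) * kp_s' K x :> A.
Proof.
have [->|n0] := eqVneq n 0; last exact: (kpf4 fam).
have -> : fset_set (vpaths (v : Obj Lam) 0) = [fset idm (v : Obj Lam)]%fset.
  apply/fsetP=> x; rewrite in_pb_vpaths inE.
  apply/andP/eqP => [[/eqP <- /eqP /deg0_idm //]|->].
  by rewrite rng_id deg_id !eqxx.
rewrite big_seq_fset1 (kpf_id fam _).1 (kpf_id fam _).2.
by rewrite -[RHS]/(p v * p v) pb_pM eqxx.
Qed.

Lemma pb_one n : 1 = \sum_(a <- paths_of_deg (f n)) s a n * s' a n :> A.
Proof.
set P := (X in _ = X); suff pP v : p v * P = p v.
  have one : 1 = \sum_(v <- fset_set [set: Obj G]) p v :> A by [].
  by rewrite -[P]mul1r one mulr_suml; apply: eq_bigr => v _; rewrite pP.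
rewrite [RHS](pb_p_sum _ n) mulr_sumr.
under eq_bigr do rewrite mulrA pb_pMs (fun_if (fun x => x * _)) mul0r.
rewrite -big_mkcond -big_filter.
have -> : \sum_(x <- fset_set (vpaths (v : Obj Lam) n)) (kp_s K x : A) * kp_s' K x =
    \sum_(a <- [seq (val x).1 | x <- fset_set (vpaths (v : Obj Lam) n)]) s a n * s' a n.
  rewrite big_map big_seq [RHS]big_seq; apply: eq_bigr => x.
  rewrite in_pb_vpaths; have [a [m [h ->]]] := pb_morP x => /andP[_ /eqP mn].
  by rewrite -mn -pb_sE -pb_s'E.
apply: perm_big; apply: uniq_perm; rewrite ?filter_uniq ?fset_uniq //.
  rewrite map_inj_in_uniq ?fset_uniq // => x y; rewrite !in_pb_vpaths.
  move=> /andP[_ /eqP xn] /andP[_ /eqP yn] e; apply: val_inj.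
  by move: xn yn e; rewrite /deg /=; case: (val x) (val y) => [? ?] [? ?] /= -> -> ->.
move=> a; rewrite mem_filter in_paths_of_deg.
apply/andP/mapP => [[/eqP ra /eqP h]|[x]].
  by exists (pb_mor h) => //; rewrite in_pb_vpaths /= -ra !eqxx.
by rewrite in_pb_vpaths => /andP[/eqP <- /eqP <-] ->; split=> //; apply: (valP x).
Qed.

End Relations.

(** * The central copy of the group algebra *)

Section CentralUnits.
Context (K : fieldType) (k l : nat) (f : {additive natv k -> natv l}).
Context (G : kgraph l) (rfG : row_finite G) (finG : finite_vertices G).

Local Notation Lam := (pullback f G).
Local Notation A := (KP K Lam finG).
Local Notation p := (pb_p K f finG).
Local Notation s := (pb_s K f finG).
Local Notation s' := (pb_s' K f finG).

Implicit Types (a b c : Mor G) (v w : Obj G) (n m : natv k).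

Let inP := in_paths_of_deg rfG finG.

Lemma pb_ps a n : p (rng a) * s a n = s a n.
Proof. by rewrite pb_pMs eqxx. Qed.
Lemma pb_sp a n : s a n * p (src a) = s a n.
Proof. by rewrite pb_sMp eqxx. Qed.
Lemma pb_ps' a n : p (src a) * s' a n = s' a n.
Proof. by rewrite pb_pMs' eqxx. Qed.
Lemma pb_s'p a n : s' a n * p (rng a) = s' a n.
Proof. by rewrite pb_s'Mp eqxx. Qed.

(** The operator that trades the degree [n] of a path for [m], for
  [f m = f n].  It depends on [m - n] only, and [pb_U] is the case
  where [m] and [n] have disjoint supports. *)
Definition pb_W m n : A := \sum_(c <- paths_of_deg G (f m)) s c m * s' c n.

Lemma pb_WMs m n c : f m = f n -> deg c = f n -> pb_W m n * s c n = s c m.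
Proof.
move=> mn dc; rewrite /pb_W mulr_suml big_seq.
under eq_bigr => a.
  rewrite inP => /eqP da.
  rewrite -mulrA pb_s'Ms -?mn ?dc // (fun_if (fun x => _ * x)) mulr0.
  have -> : (if a == c then s a m * p (src a) else 0) = if a == c then s a m else 0.
    by rewrite pb_sp.
  over.
by rewrite -big_seq sum_if_eq ?fset_uniq // inP dc mn eqxx.
Qed.

Lemma pb_s'MW m n c : f m = f n -> deg c = f m -> s' c m * pb_W m n = s' c n.
Proof.
move=> mn dc; rewrite /pb_W mulr_sumr big_seq.
under eq_bigr => a.
  rewrite inP => /eqP da.
  rewrite mulrA pb_s'Ms // eq_sym (fun_if (fun x => x * _)) mul0r.
  have -> : (if a == c then p (src c) * s' a n else 0) = if a == c then s' a n else 0.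
    by case: eqP => // ->; rewrite pb_ps'.
  over.
by rewrite -big_seq sum_if_eq ?fset_uniq // inP dc eqxx.
Qed.

Lemma pb_split c m n : deg c = f (m + n) ->
  exists a b, [/\ src a = rng b, c = comp a b, deg a = f m & deg b = f n].
Proof.
rewrite raddfD => dc; have [|a [b [h e da]]] := @factor_ex _ G c (f m).
  by rewrite dc lev_addr.
exists a, b; split=> //; apply: (@addvI _ (f m)).
by rewrite -da -deg_comp // -e dc da.
Qed.

Lemma pb_WMsD m n r c : f m = f n -> deg c = f (n + r) ->
  pb_W m n * s c (n + r) = s c (m + r).
Proof.
move=> mn /pb_split[a [b [h -> da db]]].
by rewrite -pb_sM // mulrA pb_WMs // pb_sM // mn.
Qed.

Lemma pb_s'DMW m n r c : f m = f n -> deg c = f (m + r) ->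
  s' c (m + r) * pb_W m n = s' c (n + r).
Proof.
move=> mn /pb_split[a [b [h -> da db]]].
by rewrite -pb_s'M // -mulrA pb_s'MW // pb_s'M // -mn.
Qed.

Lemma pb_WD m n r : f m = f n -> pb_W (m + r) (n + r) = pb_W m n.
Proof.
move=> mn; rewrite -[RHS]mulr1 (pb_one K f rfG finG (n + r)) mulr_sumr /pb_W.
have -> : f (m + r) = f (n + r) by rewrite !raddfD mn.
rewrite big_seq [RHS]big_seq; apply: eq_bigr => c.
by rewrite inP => /eqP dc; rewrite mulrA pb_WMsD.
Qed.

Lemma pb_W_eq m n m' n' : f m = f n -> f m' = f n' -> m + n' = m' + n ->
  pb_W m n = pb_W m' n'.
Proof.
by move=> h h' e; rewrite -(pb_WD n' h) -(pb_WD n h') e [n + _]addrC.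
Qed.

Lemma pb_WM m n r : f m = f n -> f n = f r ->
  pb_W m n * pb_W n r = pb_W m r.
Proof.
move=> mn nr; set w := pb_W m n; rewrite /pb_W mulr_sumr mn.
rewrite big_seq [RHS]big_seq; apply: eq_bigr => c.
by rewrite inP => /eqP dc; rewrite mulrA pb_WMs.
Qed.

Lemma pb_W0 : pb_W 0 0 = 1.
Proof. by rewrite (pb_one K f rfG finG 0). Qed.

Lemma pb_W_comm_s m n c r : f m = f n -> pb_W m n * s c r = s c r * pb_W m n.
Proof.
move=> mn; have [dc|/eqP/(pb_s_out K finG)[-> _]] := eqVneq (deg c) (f r); last first.
  by rewrite mulr0 mul0r.
rewrite -[LHS]mulr1 (pb_one K f rfG finG n) [in RHS]/pb_W !mulr_sumr -mn.
rewrite big_seq [RHS]big_seq; apply: eq_bigr => a.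
rewrite inP => /eqP da; rewrite !mulrA; congr (_ * _).
have [h|/eqP h] := eqVneq (src c) (rng a); last by rewrite -mulrA !pb_sM0 // mulr0.
rewrite -mulrA !pb_sM // -?mn // [r + n]addrC [r + m]addrC pb_WMsD //.
by rewrite deg_comp // dc da mn raddfD addrC.
Qed.

Lemma pb_W_comm_s' m n c r : f m = f n -> pb_W m n * s' c r = s' c r * pb_W m n.
Proof.
move=> mn; have [dc|/eqP/(pb_s_out K finG)[_ ->]] := eqVneq (deg c) (f r); last first.
  by rewrite mulr0 mul0r.
rewrite -[RHS]mul1r (pb_one K f rfG finG m) [in LHS]/pb_W !mulr_suml.
rewrite big_seq [RHS]big_seq; apply: eq_bigr => a.
rewrite inP => /eqP da; rewrite -!mulrA; congr (_ * _).
have [h|/eqP h] := eqVneq (src c) (rng a); last first.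
  have h' n' : s' a n' * s' c r = 0.
    rewrite -(pb_s'p a) -mulrA pb_pMs'; case: eqP => [/h|_] //; by rewrite mulr0.
  by rewrite h' mulrA h' mul0r.
rewrite mulrA !pb_s'M // -?mn // [r + n]addrC [r + m]addrC pb_s'DMW //.
by rewrite deg_comp // dc da raddfD addrC.
Qed.

Lemma pb_central (z : A) : (forall c n, z * s c n = s c n * z) ->
  (forall c n, z * s' c n = s' c n * z) -> forall x, z * x = x * z.
Proof.
move=> zs zs' x.
have gs (y : Mor Lam) : (z * kp_s K y = (kp_s K y : A) * z) *
    (z * kp_s' K y = (kp_s' K y : A) * z).
  have [a [n [h ->]]] := pb_morP y.
  by rewrite -(pb_sE K finG h) -(pb_s'E K finG h) zs zs'.
elim/kp_piW: x; elim=> [v|a|a||x IHx y IHy|c x IHx|x IHx y IHy].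
- change (z * p v = p v * z); by rewrite -(pb_s_idm K f finG v).1 zs.
- exact: (gs a).1.
- exact: (gs a).2.
- by change (z * 0 = 0 * z); rewrite mulr0 mul0r.
- by rewrite kp_piD mulrDr IHx IHy -mulrDl.
- by rewrite kp_piZ [LHS]kp_scaleAr [RHS]kp_scaleAl; congr (_ *: _).
- by rewrite kp_pi_mul -/(GRing.mul _ _) mulrA IHx -mulrA IHy mulrA.
Qed.

Lemma pb_W_central m n (x : A) : f m = f n -> pb_W m n * x = x * pb_W m n.
Proof.
move=> mn; move: x; apply: pb_central => *; first exact: pb_W_comm_s.
exact: pb_W_comm_s'.
Qed.

End CentralUnits.

Section GroupAlgebraAction.
Context (K : fieldType) (k l : nat) (f : {additive natv k -> natv l}).
Context (G : kgraph l) (rfG : row_finite G) (finG : finite_vertices G).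

Local Notation Lam := (pullback f G).
Local Notation A := (KP K Lam finG).
Local Notation C := (galg K (kerf f)).
Local Notation p := (pb_p K f finG).
Local Notation s := (pb_s K f finG).
Local Notation s' := (pb_s' K f finG).
Local Notation U := (pb_U K (f := f) finG).
Local Notation W := (pb_W K f finG).

Implicit Types (m n : natv k) (h g : kerf f) (c d : C).

Lemma toZ_inj j : injective (@toZ j).
Proof.
by move=> m n /ffunP h; apply/ffunP=> i; move: (h i); rewrite !ffunE => -[].
Qed.

Lemma toZD j (m n : natv j) : toZ (m + n) = toZ m + toZ n.
Proof. by apply/ffunP=> i; rewrite !ffunE. Qed.

Lemma kerf_pos_neg h : f (posv (val h)) = f (negv (val h)).
Proof.
have := valP h; rewrite inE /fbar subr_eq0 => /eqP.
exact: toZ_inj.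
Qed.

Lemma pb_UE h : U h = W (posv (val h)) (negv (val h)).
Proof.
rewrite /pb_U; set m := posv _; set n := negv _.
have one : 1 = \sum_(v <- fset_set [set: Obj G]) p v :> A by [].
rewrite -[RHS]mul1r one mulr_suml; apply: eq_bigr => v _.
rewrite /pb_W mulr_sumr.
under [RHS]eq_bigr do rewrite mulrA pb_pMs (fun_if (fun x => x * _)) mul0r.
rewrite -big_mkcond -[RHS]big_filter; apply: perm_big.
apply: uniq_perm; rewrite ?filter_uniq ?fset_uniq // => a.
rewrite mem_filter (in_paths_of_deg rfG) // in_fset_set; last exact: rfG.
by apply/idP/andP => [/set_mem[-> ->] //|[/eqP ? /eqP ?]]; apply/mem_set.
Qed.

Lemma pb_U_W m n h : f m = f n -> val h = toZ m - toZ n -> U h = W m n.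
Proof.
move=> mn hE; rewrite pb_UE; apply: pb_W_eq => //; first exact: kerf_pos_neg.
have /eqP : toZ (posv (val h)) - toZ (negv (val h)) = toZ m - toZ n.
  by rewrite -posvK.
by rewrite subr_eq => /eqP e; apply: toZ_inj; rewrite !toZD e addrAC subrK.
Qed.

Lemma pb_U0 : U 0 = 1.
Proof.
by rewrite (@pb_U_W 0 0) // ?pb_W0 // subrr.
Qed.

Lemma pb_UM h g : U h * U g = U (h + g).
Proof.
have eh := kerf_pos_neg h; have eg := kerf_pos_neg g.
have zh := posvK (val h); have zg := posvK (val g).
rewrite (@pb_U_W (posv (val h) + posv (val g)) (negv (val h) + posv (val g)) h);
  first last.
- by rewrite !toZD {1}zh opprD addrACA subrr addr0.
- by rewrite !raddfD eh.
rewrite (@pb_U_W (negv (val h) + posv (val g)) (negv (val h) + negv (val g)) g);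
  first last.
- by rewrite !toZD {1}zg opprD addrACA subrr add0r.
- by rewrite !raddfD eg.
rewrite pb_WM ?raddfD ?eh ?eg //.
rewrite (@pb_U_W (posv (val h) + posv (val g)) (negv (val h) + negv (val g))) //.
  by rewrite !raddfD /= eh eg.
by rewrite !toZD raddfD /= {1}zh {1}zg opprD addrACA.
Qed.

Lemma pb_U_central h (x : A) : U h * x = x * U h.
Proof. by rewrite pb_UE; apply: pb_W_central => //; apply: kerf_pos_neg. Qed.

Lemma iotaEw (D : {fset kerf f}) c : (msupp c `<=` D)%fset ->
  iota finG c = \sum_(h <- D) c@_h *: U h.
Proof.
move=> cD; apply: big_fset_incl => // h _ /mcoeff_outdom ->.
by rewrite scale0r.
Qed.

Lemma iotaD c d : iota finG (c + d) = iota finG c + iota finG d.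
Proof.
have le := msuppD_le c d.
rewrite (iotaEw le) (iotaEw (fsubsetUl (msupp c) (msupp d))).
rewrite (iotaEw (fsubsetUr (msupp c) (msupp d))) -big_split /=.
by apply: eq_bigr => h _; rewrite mcoeffD scalerDl.
Qed.

Lemma iotaU (x : K) h : iota finG (<< x *g h >> : C) = x *: U h.
Proof. by rewrite (iotaEw msuppU_le) big_seq_fset1 mcoeffUU. Qed.

Lemma iota0 : iota finG (0 : C) = 0.
Proof. by rewrite /iota msupp0 big_seq_fset0. Qed.

Lemma iota1 : iota finG (1 : C) = 1.
Proof. by rewrite [LHS]iotaU scale1r pb_U0. Qed.

Lemma iota_sum (I : Type) (r : seq I) (P : pred I) (F : I -> C) :
  iota finG (\sum_(i <- r | P i) F i) = \sum_(i <- r | P i) iota finG (F i).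
Proof. by apply: (big_morph (iota finG)); [apply: iotaD | apply: iota0]. Qed.

Lemma pb_scalerAl (x : K) (a b : A) : (x *: a) * b = x *: (a * b).
Proof. exact: kp_scaleAl. Qed.
Lemma pb_scalerAr (x : K) (a b : A) : a * (x *: b) = x *: (a * b).
Proof. exact: kp_scaleAr. Qed.

Lemma iota_central c (x : A) : iota finG c * x = x * iota finG c.
Proof.
rewrite /iota mulr_suml mulr_sumr; apply: eq_bigr => h _.
by rewrite pb_scalerAl pb_U_central pb_scalerAr.
Qed.

Lemma galgUE c : c = \sum_(h <- msupp c) (<< c@_h *g h >> : C).
Proof. exact: monalgE. Qed.

Lemma iotaM c d : iota finG (c * d) = iota finG c * iota finG d.
Proof.
rewrite /iota -/(iota finG (c * d)) mulr_suml [c * d]/(galg_mul c d) /galg_mul.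
rewrite iota_sum; apply: eq_bigr => h _.
rewrite iota_sum mulr_sumr; apply: eq_bigr => g _.
by rewrite iotaU pb_scalerAl pb_scalerAr scalerA pb_UM.
Qed.

Lemma iotaN c : iota finG (- c) = - iota finG c.
Proof. by apply/eqP; rewrite -subr_eq0 opprK -iotaD addNr iota0. Qed.

End GroupAlgebraAction.

(** * The algebra over its central group algebra *)

(** A splitting of [f]: it identifies the pullback algebra with the group
  algebra of the kernel over the algebra of [G]. *)
Lemma degree_section (k l : nat) (f : {additive natv k -> natv l}) :
  (forall n, exists m, f m = n) -> exists g : natv l -> natv k,
    [/\ g 0 = 0, {morph g : m n / m + n} & forall n, f (g n) = n].
Proof.
move=> fs; pose e (j : 'I_l) : natv l := [ffun i => (i == j : nat)].
have [u fu] := choice (fun j => fs (e j)).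
exists (fun n => \sum_j u j *+ n j); split.
- by rewrite big1 // => j _; rewrite ffunE mulr0n.
- move=> m n; rewrite -big_split /=; apply: eq_bigr => j _.
  by rewrite ffunE mulrnDr.
- move=> n; rewrite raddf_sum; apply/ffunP=> i.
  rewrite sum_ffunE (bigD1 i) //= big1 ?addr0 => [|j ji].
    by rewrite raddfMn fu ffunMnE ffunE eqxx; apply: natn.
  by rewrite raddfMn fu ffunMnE ffunE eq_sym (negPf ji) mul0rn.
Qed.

Section Family.
Context (K : fieldType) (k l : nat) (f : {additive natv k -> natv l}).
Context (G : kgraph l) (rfG : row_finite G) (finG : finite_vertices G).
Context (g : natv l -> natv k) (gD : {morph g : m n / m + n}).
Context (fg : forall n, f (g n) = n).

Local Notation Lam := (pullback f G).
Local Notation A := (KP K Lam finG).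
Local Notation C := (galg K (kerf f)).
Local Notation p := (pb_p K f finG).
Local Notation s := (pb_s K f finG).
Local Notation s' := (pb_s' K f finG).
Local Notation U := (pb_U K (f := f) finG).
Local Notation io := (iota finG : C -> A).

Implicit Types (a b c : Mor G) (x y : A).

(** The Kumjian-Pask family of [G] carried by the section [g]. *)
Definition gam a : A := s a (g (deg a)).
Definition gam' a : A := s' a (g (deg a)).

Lemma gamM a b : src a = rng b -> gam a * gam b = gam (comp a b).
Proof. by move=> h; rewrite /gam pb_sM // deg_comp // gD. Qed.

Lemma gam'M a b : src a = rng b -> gam' b * gam' a = gam' (comp a b).
Proof. by move=> h; rewrite /gam' pb_s'M // deg_comp // gD. Qed.

Lemma gam'Mgam a b : deg a = deg b ->
  gam' a * gam b = if a == b then p (src a) else 0.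
Proof. by move=> h; rewrite /gam /gam' h pb_s'Ms ?fg. Qed.

Lemma gam_one n : 1 = \sum_(a <- paths_of_deg G n) gam a * gam' a :> A.
Proof.
rewrite (pb_one K f rfG finG (g n)) fg big_seq [RHS]big_seq.
by apply: eq_bigr => a; rewrite in_paths_of_deg // /gam /gam' => /eqP ->.
Qed.

Lemma gam'Mgam_no_prefix a b : lev (deg a) (deg b) ->
  (forall c, src a = rng c -> b <> comp a c) -> gam' a * gam b = 0.
Proof.
move=> /factor_ex[b1 [b2 [h -> db]]] n.
rewrite -gamM // mulrA gam'Mgam //; case: eqP => [e|_]; last by rewrite mul0r.
by case: (n b2); rewrite e.
Qed.

Lemma gam'Mgam_no_prefix' a b : lev (deg b) (deg a) ->
  (forall c, src b = rng c -> a <> comp b c) -> gam' a * gam b = 0.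
Proof.
move=> /factor_ex[a1 [a2 [h -> da]]] n.
rewrite -gam'M // -mulrA gam'Mgam //; case: eqP => [e|_]; last by rewrite mulr0.
by case: (n a2); rewrite -e.
Qed.

(** Decompose the unit between the two factors by paths [c] longer than both:
  a nonzero contribution of [c] makes it a common prolongation. *)
Lemma gam'Mgam_disjoint a b :
  (forall c d, src a = rng c -> src b = rng d -> comp a c <> comp b d) ->
  gam' a * gam b = 0.
Proof.
move=> n; rewrite -[gam' a]mulr1 (gam_one (deg a + deg b)) mulr_sumr mulr_suml.
rewrite big_seq big1 // => c; rewrite in_paths_of_deg // => /eqP dc.
have [[d hd ed]|h] := pselect (exists2 d, src a = rng d & c = comp a d); last first.
  rewrite mulrA gam'Mgam_no_prefix ?mul0r //; first by rewrite dc lev_addr.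
  by move=> d h1 h2; apply: h; exists d.
rewrite -!mulrA gam'Mgam_no_prefix' ?mulr0 //; first by rewrite dc lev_addl.
by move=> d' h1 h2; apply: (n d d') => //; rewrite -ed.
Qed.

Fact ker_part_subproof n : toZ n - toZ (g (f n)) \in kerf_pred f.
Proof. by rewrite inE raddfB /= !fbar_toZ fg subrr. Qed.

(** The component of the degree [n] along the kernel, in the decomposition
  given by the section [g]. *)
Definition ker_part n : kerf f := Sub (toZ n - toZ (g (f n))) (ker_part_subproof n).

Definition ug (h : kerf f) : C := << 1 *g h >>.

Lemma iota_ug h : io (ug h) = U h.
Proof. by rewrite [LHS]iotaU scale1r. Qed.

Lemma pb_s_gam a n : deg a = f n -> s a n = io (ug (ker_part n)) * gam a.
Proof.
move=> da; rewrite iota_ug (pb_U_W K rfG finG (m := n) (n := g (f n))) ?fg //.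
by rewrite /gam da pb_WMs ?fg.
Qed.

Lemma pb_s'_gam a n : deg a = f n -> s' a n = io (ug (- ker_part n)) * gam' a.
Proof.
move=> da; rewrite iota_ug (pb_U_W K rfG finG (m := g (f n)) (n := n)) ?fg //; last first.
  by rewrite raddfN /= opprB.
by rewrite pb_W_central ?fg // /gam' da pb_s'MW ?fg.
Qed.

Lemma kp_s_gam (z : Mor Lam) :
  kp_s K z = io (ug (ker_part (deg z))) * gam (val z).1 /\
  kp_s' K z = io (ug (- ker_part (deg z))) * gam' (val z).1.
Proof.
have [a [n [h ->]]] := pb_morP z.
split; first exact: etrans (esym (pb_sE K finG h)) (pb_s_gam h).
exact: etrans (esym (pb_s'E K finG h)) (pb_s'_gam h).
Qed.

Definition path_span (w : Obj G) (e : natv l) (x : A) : Prop :=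
  exists2 r : seq (C * Mor G),
    (forall z, z \in r -> src z.2 = w /\ lev e (deg z.2)) &
    x = \sum_(z <- r) io z.1 * gam z.2.

Lemma path_span0 w e : path_span w e 0.
Proof. by exists [::]; rewrite ?big_nil. Qed.

Lemma path_spanD w e x y :
  path_span w e x -> path_span w e y -> path_span w e (x + y).
Proof.
move=> [r hr ->] [r' hr' ->]; exists (r ++ r'); last by rewrite big_cat.
by move=> z; rewrite mem_cat => /orP[/hr|/hr'].
Qed.

Lemma path_spanZ w e (c : C) x : path_span w e x -> path_span w e (io c * x).
Proof.
move=> [r hr ->]; exists [seq (c * z.1, z.2) | z <- r].
  by move=> y /mapP[z /hr h ->].
by rewrite big_map mulr_sumr; apply: eq_bigr => z _; rewrite iotaM // mulrA.
Qed.

Lemma path_span_gam e a : lev e (deg a) -> path_span (src a) e (gam a).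
Proof.
move=> ea; exists [:: (1, a)]; last by rewrite big_seq1 iota1 // mul1r.
by move=> z; rewrite inE => /eqP ->.
Qed.

Lemma path_span_sum w e (I : eqType) (r : seq I) (F : I -> A) :
  (forall i, i \in r -> path_span w e (F i)) ->
  path_span w e (\sum_(i <- r) F i).
Proof.
move=> h; rewrite big_seq; elim/big_ind: _ => //; first exact: path_span0.
by move=> x y; apply: path_spanD.
Qed.

(** A ghost path [gam' b] removes [b] from the front of any path long enough to
  compare with it, so that only paths remain after multiplication by a long
  path.  The parameter [e] keeps them long enough for a second factor, which
  makes the property stable under products. *)
Lemma mul_long_path x : exists N, forall e a, lev (N + e) (deg a) ->
  path_span (src a) e (x * gam a).
Proof.
have le0 e (n : natv l) : lev (0 + e) n -> lev e n by rewrite add0r.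
have ioE (c : C) x' : (exists N, forall e a, lev (N + e) (deg a) ->
      path_span (src a) e (x' * gam a)) ->
    exists N, forall e a, lev (N + e) (deg a) ->
      path_span (src a) e (io c * x' * gam a).
  by move=> [N hN]; exists N => e a /hN h; rewrite -mulrA; apply: path_spanZ.
elim/kp_piW: x; elim=> [v|b|b||x [N hN] y [N' hN']|c x|x [N hN] y [N' hN']].
- exists 0 => e a /le0 h; change (path_span (src a) e (p v * gam a)).
  rewrite pb_pMs; case: ifP => _; last exact: path_span0.
  exact: path_span_gam.
- change (exists N, forall e a, lev (N + e) (deg a) ->
    path_span (src a) e ((kp_s K b : A) * gam a)).
  rewrite (kp_s_gam b).1; apply: ioE; set b1 := (val b).1.
  exists 0 => e a /le0 h; have [h'|/eqP h'] := eqVneq (src b1) (rng a).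
    rewrite gamM // -(src_comp h'); apply: path_span_gam.
    by rewrite deg_comp //; apply: lev_trans h (lev_addl _ _).
  by rewrite pb_sM0 //; apply: path_span0.
- change (exists N, forall e a, lev (N + e) (deg a) ->
    path_span (src a) e ((kp_s' K b : A) * gam a)).
  rewrite (kp_s_gam b).2; apply: ioE; set b1 := (val b).1.
  exists (deg b1) => e a h.
  have /factor_ex[a1 [a2 [ha e' da]]] := lev_trans (lev_addr _ _) h.
  rewrite e' -gamM // mulrA gam'Mgam //.
  case: eqP => [e2|_]; last by rewrite mul0r; apply: path_span0.
  rewrite pb_pMs src_comp //; case: ifP => _; last exact: path_span0.
  apply: path_span_gam; move: h; rewrite e' deg_comp // da.
  by rewrite levD2l.
- exists 0 => e a _; change (path_span (src a) e (0 * gam a)).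
  by rewrite mul0r; apply: path_span0.
- exists (N + N') => e a h; rewrite kp_piD mulrDl.
  apply: path_spanD; [apply: hN | apply: hN']; apply: lev_trans h.
    by rewrite addrAC lev_addr.
  by rewrite -addrA lev_addl.
- rewrite kp_piZ => h.
  have := ioE (<< c *g 0 >> : C) _ h; rewrite iotaU pb_U0 //.
  by under eq_exists do under eq_forall do rewrite pb_scalerAl mul1r.
- exists (N + N') => e a h; rewrite kp_pi_mul -/(GRing.mul _ _) -mulrA.
  have h' : lev (N' + (N + e)) (deg a) by rewrite addrCA addrA.
  have [r hr ->] := hN' _ _ h'.
  rewrite mulr_sumr; apply: path_span_sum => z /hr[<- hz].
  by rewrite mulrA -iota_central // -mulrA; apply: path_spanZ; apply: hN.
Qed.

Lemma path_span_coef w e x : path_span w e x ->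
  exists (D : seq (Mor G)) (c : Mor G -> C), [/\ uniq D,
    forall a, a \in D -> src a = w & x = \sum_(a <- D) io (c a) * gam a].
Proof.
move=> [r hr ->]; exists (undup [seq z.2 | z <- r]).
exists (fun a => \sum_(z <- r | z.2 == a) z.1); split; first exact: undup_uniq.
  by move=> a; rewrite mem_undup => /mapP[z /hr[<- _] ->].
under [RHS]eq_bigr do rewrite iota_sum // mulr_suml big_mkcond.
rewrite exchange_big /= big_seq [RHS]big_seq; apply: eq_bigr => z zr.
under eq_bigr => a _.
  have -> : (if z.2 == a then io z.1 * gam a else 0) =
      (if a == z.2 then io z.1 * gam a else 0) by rewrite eq_sym.
  over.
rewrite (sum_if_eq (fun a => io z.1 * gam a)) ?undup_uniq //.
by rewrite mem_undup map_f.
Qed.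

End Family.

(** * The uniqueness lemma *)

Section IdealFacts.
Context (R : pzRingType).
Implicit Types I J : set R.

Lemma ideal0 I : ideal I -> I 0.
Proof. by case. Qed.
Lemma idealD I x y : ideal I -> I x -> I y -> I (x + y).
Proof. by case=> _ h _; apply: h. Qed.
Lemma idealMl I a x : ideal I -> I x -> I (a * x).
Proof. by case=> _ _ h /(h a)[]. Qed.
Lemma idealMr I a x : ideal I -> I x -> I (x * a).
Proof. by case=> _ _ h /(h a)[]. Qed.
Lemma idealN I x : ideal I -> I x -> I (- x).
Proof. by move=> h /(idealMl (-1) h); rewrite mulN1r. Qed.
Lemma ideal_sum I (T : eqType) (r : seq T) (F : T -> R) : ideal I ->
  (forall i, i \in r -> I (F i)) -> I (\sum_(i <- r) F i).
Proof.
move=> iI h; rewrite big_seq; elim/big_ind: _ => //; first exact: ideal0.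
by move=> x y; apply: idealD.
Qed.

Lemma ideal_sumset I J : ideal I -> ideal J ->
  ideal [set x + y | x in I & y in J].
Proof.
move=> iI iJ; split.
- by exists 0; [exact: ideal0|exists 0; [exact: ideal0|rewrite addr0]].
- move=> _ _ [x Ix [y Jy <-]] [x' Ix' [y' Jy' <-]].
  exists (x + x'); first exact: idealD.
  by exists (y + y'); [exact: idealD|rewrite addrACA].
- move=> a _ [x Ix [y Jy <-]]; split.
    exists (a * x); first exact: idealMl.
    by exists (a * y); [exact: idealMl|rewrite mulrDr].
  exists (x * a); first exact: idealMr.
  by exists (y * a); [exact: idealMr|rewrite mulrDl].
Qed.

Lemma ideal_proper I : ideal I -> I <> setT -> ~ I 1.
Proof.
move=> iI nI I1; apply: nI; apply/seteqP; split=> // x _.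
by rewrite -[x]mulr1; apply: idealMl.
Qed.

End IdealFacts.

Section MaximalTailFacts.
Context {l : nat} (G : kgraph l) (T : MT G).

Lemma mt_upward v w : val T w -> reach v w -> val T v.
Proof. by have [_ h _ _] := set_mem (valP T); apply: h. Qed.

Lemma mt_hereditary : hereditary (~` val T).
Proof. by move=> v w nTv vw Tw; apply: nTv; apply: mt_upward vw. Qed.

Lemma mt_saturated : saturated (~` val T).
Proof.
move=> v n _ h Tv; have [_ _ mt2 _] := set_mem (valP T).
by have [a va Ta] := mt2 v n Tv; apply: h va Ta.
Qed.

Lemma mt_compl_proper : ~` val T <> setT.
Proof.
have [[v Tv] _ _ _] := set_mem (valP T).
by move=> e; have : (~` val T) v by rewrite e.
Qed.

End MaximalTailFacts.

Section Uniqueness.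
Context (K : fieldType) (k l : nat) (f : {additive natv k -> natv l}).
Context (f_surj : forall n : natv l, exists m : natv k, f m = n).
Context (G : kgraph l) (rfG : row_finite G) (finG : finite_vertices G).

Local Notation Lam := (pullback f G).
Local Notation A := (KP K Lam finG).
Local Notation C := (galg K (kerf f)).
Local Notation p := (pb_p K f finG).
Local Notation io := (iota finG : C -> A).

Implicit Types (a b : Mor G) (c : C) (x y : A) (T : MT G) (m : set C).

(** The ideal [P_ideal T m], for an arbitrary set [m]. *)
Definition tail_ideal T m : set A :=
  [set x + y | x in vertex_ideal T & y in extended_ideal m].

Lemma extended_ideal_ideal m : ideal (extended_ideal m : set A).
Proof.
split; first by exists [::]; rewrite ?big_nil.
  move=> _ _ [r hr ->] [r' hr' ->]; exists (r ++ r'); last by rewrite big_cat.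
  by move=> z; rewrite mem_cat => /orP[/hr|/hr'].
move=> a _ [r hr ->]; split.
  exists [seq (a * z.1, z.2) | z <- r]; first by move=> z /mapP[y /hr h ->].
  by rewrite big_map mulr_sumr; apply: eq_bigr => z _; rewrite mulrA.
exists [seq (z.1 * a, z.2) | z <- r]; first by move=> z /mapP[y /hr h ->].
rewrite big_map mulr_suml; apply: eq_bigr => z _.
by rewrite -!mulrA iota_central.
Qed.

Lemma tail_ideal_ideal T m : ideal (tail_ideal T m).
Proof. by apply: ideal_sumset; [exact: ideal_gen_ideal|exact: extended_ideal_ideal]. Qed.

Lemma tail_ideal_p T m v : ~ val T v -> tail_ideal T m (p v).
Proof.
move=> nTv; exists (p v); first by apply: sub_ideal_gen; exists v.
by exists 0; [exact: ideal0 (extended_ideal_ideal m)|rewrite addr0].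
Qed.

Lemma tail_ideal_iota T m c : m c -> tail_ideal T m (io c).
Proof.
move=> mc; exists 0; first exact: ideal0 (ideal_gen_ideal _).
exists (io c); last by rewrite add0r.
exists [:: (1, c)]; last by rewrite big_seq1 mul1r.
by move=> z; rewrite inE => /eqP ->.
Qed.

Lemma tail_ideal_min T m (I : set A) : ideal I ->
  (forall v, ~ val T v -> I (p v)) -> (forall c, m c -> I (io c)) ->
  tail_ideal T m `<=` I.
Proof.
move=> iI Ip Ic _ [x hx [y [r hr ->] <-]]; apply: idealD => //.
  by apply: hx => // _ [v nv <-]; apply: Ip.
apply: ideal_sum => // z /hr mz; apply: idealMl => //; exact: Ic.
Qed.

(** This plays the role of both the gauge-invariant and the Cuntz-Krieger
  uniqueness theorems.  Multiplying by a long path turns [x] into a combination of paths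
  with the same source, of which one, [b], has a coefficient outside [m]; an
  aperiodic path [z] of the tail then kills every other term of the
  compression by [b z(0,q)] and [z(0,q)]. *)
Lemma tail_uniqueness (sapG : strongly_aperiodic G) T m x : ideal m ->
  ~ tail_ideal T m x ->
  exists v c, [/\ val T v, ~ m c & ideal_gen [set x] (p v * io c)].
Proof.
move=> im nQx; set Q := tail_ideal T m in nQx; have iQ : ideal Q := tail_ideal_ideal T m.
have [g [g0 gD fg]] := degree_section f_surj.
pose gm := gam K f finG g; pose gm' := gam' K f finG g.
have [N hN] := mul_long_path rfG gD fg x.
(* [x] is the sum of the [x * gm a * gm' a] over the paths of degree [N]. *)
have [a da nQa] : exists2 a, deg a = N & ~ Q (x * gm a).
  apply: contrapT => /forall2NP h; apply: nQx.
  rewrite -[x]mulr1 (gam_one K rfG finG fg N) mulr_sumr; apply: ideal_sum => // a.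
  rewrite in_paths_of_deg // => /eqP da; rewrite mulrA; apply: idealMr => //.
  by have [//|/contrapT] := h a.
have Tsa : val T (src a).
  apply: contrapT => nT; apply: nQa; rewrite -[gm a]pb_sp mulrA.
  by apply: idealMl => //; apply: tail_ideal_p.
have [|D [c [uD sD xa]]] := path_span_coef (hN 0 a _); first by rewrite addr0 da lev_refl.
have [b bD nmb] : exists2 b, b \in D & ~ m (c b).
  apply: contrapT => /forall2NP h; apply: nQa; rewrite xa.
  apply: ideal_sum => // b bD; apply: idealMr => //; apply: tail_ideal_iota.
  by have [//|/contrapT] := h b.
have apT : aperiodic (remove (@mt_hereditary _ _ T)).
  by apply: sapG; [exact: mt_saturated|exact: mt_compl_proper].
have nLsa : ~ (~` val T) (src a) by [].
have [z [iz z0 zT zap]] := aperiodic_path_remove apT nLsa.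
have sz q b' : b' \in D -> src b' = rng (z 0 q).
  by move=> b'D; rewrite path_rng0 // z0 sD.
have kill b' : exists q0, b' \in D -> b' != b -> forall q, lev q0 q ->
    gm' (comp b (z 0 q)) * gm (comp b' (z 0 q)) = 0.
  have [b'D|] := boolP (b' \in D); last by exists 0.
  have szb q := sz q b bD; have szb' q := sz q b' b'D.
  have [e|/eqP ne] := eqVneq (deg b') (deg b).
    exists 0 => _ ne q _; rewrite /gm /gm' gam'Mgam //; last first.
      by rewrite (deg_comp (szb q)) (deg_comp (szb' q)) e.
    case: eqP => // e2; case/eqP: ne.
    by have [-> _] := factor_uniq (szb q) (szb' q) e2 (esym e).
  have [] := @aperiodic_separates _ G z b b' iz; rewrite ?z0 ?sD //.
    by apply: zap => h; apply: ne.
  move=> q0 hq0; exists q0 => _ _ q /hq0 h.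
  apply: (gam'Mgam_disjoint K rfG finG gD fg) => // u u'.
  rewrite (src_comp (szb q)) (src_comp (szb' q)) => hu hu' e.
  by apply: (h u u') => //; rewrite (comp_assoc (szb q)) ?(comp_assoc (szb' q)).
have [q0 hq0] := choice kill.
(* One degree that is beyond the bounds for all the terms. *)
pose q := \sum_(b' <- D) q0 b'.
have lq b' : b' \in D -> lev (q0 b') q.
  by move=> b'D; rewrite /q (bigD1_seq b') //= lev_addr.
exists (src (z 0 q)), (c b); split=> //.
  by apply: contrapT => h; apply: (zT 0 q).
suff -> : p (src (z 0 q)) * io (c b) =
    gm' (comp b (z 0 q)) * (x * (gm a * gm (z 0 q))).
  have iI := ideal_gen_ideal [set x].
  by apply: (idealMl _ iI); apply: (idealMr _ iI); apply: sub_ideal_gen.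
rewrite !mulrA -[_ * x * _]mulrA xa mulr_sumr mulr_suml (bigD1_seq b) //=.
rewrite [X in _ = _ + X]big_seq_cond big1 ?addr0 => [|b' /andP[b'D nb']].
  rewrite mulrA -[gm' _ * io _]iota_central // -!mulrA gamM ?(sz q b) //.
  by rewrite gam'Mgam // eqxx src_comp ?(sz q b) // iota_central.
rewrite mulrA -iota_central // -!mulrA gamM ?(sz q b') //.
by rewrite [X in _ * X]hq0 ?mulr0 // lq.
Qed.

End Uniqueness.

(** * A representation attached to a maximal tail *)

Section Representation.
Context (K : fieldType) (k l : nat) (f : {additive natv k -> natv l}).
Context (G : kgraph l) (rfG : row_finite G) (finG : finite_vertices G).
Context (g : natv l -> natv k) (g0 : g 0 = 0).
Context (gD : {morph g : m n / m + n}) (fg : forall n, f (g n) = n).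

Local Notation Lam := (pullback f G).
Local Notation A := (KP K Lam finG).
Local Notation p := (pb_p K f finG).
Local Notation hh := (ker_part fg).

Context (C : comNzRingType) (kc : K -> C) (ug : kerf f -> C).
Context (kcM : forall x y, kc x * kc y = kc (x * y)) (kc0 : kc 0 = 0).
Context (kcD : forall x y, kc (x + y) = kc x + kc y) (kc1 : kc 1 = 1).
Context (ugD : forall h h', ug h * ug h' = ug (h + h')) (ug0 : ug 0 = 1).
Context (T : MT G) (m : set C) (im : ideal m).

Local Notation V := (Mor G -> C).

Implicit Types (a b : Mor G) (c : C) (xi eta : V).

Lemma hhD n n' : hh (n + n') = hh n + hh n'.
Proof.
by apply: val_inj; rewrite /= raddfD gD !toZD opprD addrACA.
Qed.

Lemma hh0 : hh 0 = 0.
Proof. by apply: val_inj; rewrite /= raddf0 g0 subrr. Qed.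

(** The generators act on functions of paths by adding or removing an initial
  segment.  All the relations hold exactly, except that (KP4) fails on the
  paths whose degree is too small. *)
Fixpoint act (t : kp_term K Lam) (xi : V) : V := match t with
  | KPp v => fun mu => if rng mu == v :> Obj G then xi mu else 0
  | KPs z => fun mu =>
      oapp (fun nu => ug (hh (deg z)) * xi nu) 0 (strip (val z).1 mu)
  | KPs' z => fun mu => if src (val z).1 == rng mu
      then ug (- hh (deg z)) * xi (comp (val z).1 mu) else 0
  | KP0 => fun=> 0
  | KPadd x y => fun mu => act x xi mu + act y xi mu
  | KPscale c x => fun mu => kc c * act x xi mu
  | KPmul x y => act x (act y xi) end.

(** Hence the passage to the quotient by the functions that are in [m] on all
  long enough paths with source in the tail. *)
Definition null xi : Prop :=
  exists N, forall mu, lev N (deg mu) -> val T (src mu) -> m (xi mu).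

Definition sim xi eta : Prop := null (fun mu => xi mu - eta mu).

Lemma eq_sim xi eta : xi =1 eta -> sim xi eta.
Proof. by move=> e; exists 0 => mu _ _; rewrite e subrr; apply: ideal0. Qed.

Lemma nullD xi eta : null xi -> null eta -> null (fun mu => xi mu + eta mu).
Proof.
move=> [N hN] [N' hN']; exists (N + N') => mu le Tm.
apply: (idealD im); [apply: hN | apply: hN'] => //; apply: lev_trans le.
  exact: lev_addr.
exact: lev_addl.
Qed.

Lemma nullZ c xi : null xi -> null (fun mu => c * xi mu).
Proof. by move=> [N hN]; exists N => mu le Tm; apply: (idealMl _ im); apply: hN. Qed.

Lemma null_sim xi eta : sim xi eta -> null eta -> null xi.
Proof.
move=> h /(nullD h); congr (null _); apply/funext=> mu /=.
by rewrite subrK.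
Qed.

Lemma sim_sym xi eta : sim xi eta -> sim eta xi.
Proof.
move=> /(nullZ (-1)); congr (null _); apply/funext=> mu /=.
by rewrite mulN1r opprB.
Qed.

Lemma sim_trans eta xi zeta : sim xi eta -> sim eta zeta -> sim xi zeta.
Proof.
move=> h /(nullD h); congr (null _); apply/funext=> mu /=.
by rewrite addrA subrK.
Qed.

Lemma simD xi xi' eta eta' : sim xi xi' -> sim eta eta' ->
  sim (fun mu => xi mu + eta mu) (fun mu => xi' mu + eta' mu).
Proof.
move=> h /(nullD h); congr (null _); apply/funext=> mu /=.
by rewrite opprD addrACA.
Qed.

Lemma simZ c xi eta : sim xi eta ->
  sim (fun mu => c * xi mu) (fun mu => c * eta mu).
Proof.
move=> /(nullZ c); congr (null _); apply/funext=> mu /=.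
by rewrite mulrBr.
Qed.

Lemma actD t xi eta mu :
  act t (fun mu => xi mu + eta mu) mu = act t xi mu + act t eta mu.
Proof.
elim: t xi eta mu => /= [v|z|z||x IHx y IHy|c x IHx|x IHx y IHy] xi eta mu.
- by case: ifP => _; rewrite // addr0.
- by case: strip => [nu|] /=; [rewrite mulrDr | rewrite addr0].
- by case: ifP => _; [rewrite mulrDr | rewrite addr0].
- by rewrite addr0.
- by rewrite IHx IHy addrACA.
- by rewrite IHx mulrDr.
- by rewrite -IHx; congr (act x _ _); apply/funext.
Qed.

Lemma actZ t c xi mu : act t (fun mu => c * xi mu) mu = c * act t xi mu.
Proof.
elim: t xi mu => /= [v|z|z||x IHx y IHy|e x IHx|x IHx y IHy] xi mu.
- by case: ifP => _; rewrite // mulr0.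
- by case: strip => [nu|] /=; [rewrite mulrCA | rewrite mulr0].
- by case: ifP => _; [rewrite mulrCA | rewrite mulr0].
- by rewrite mulr0.
- by rewrite IHx IHy mulrDr.
- by rewrite IHx mulrCA.
- by rewrite -IHx; congr (act x _ _); apply/funext.
Qed.

Lemma act_null t xi : null xi -> null (act t xi).
Proof.
elim: t xi => /= [v|z|z||x IHx y IHy|e x IHx|x IHx y IHy] xi h.
- have [N hN] := h; exists N => mu le Tm; case: ifP => _; last exact: ideal0.
  exact: hN.
- have [N hN] := h; exists (deg (val z).1 + N) => mu le Tm.
  have [[nu hz [e ->]]|[_ ->]] := stripP (val z).1 mu; last exact: ideal0.
  apply: (idealMl _ im); apply: hN; last by rewrite -(src_comp hz) -e.
  by move: le; rewrite e deg_comp // levD2l.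
- have [N hN] := h; exists N => mu le Tm; case: eqP => hz; last exact: ideal0.
  apply: (idealMl _ im); apply: hN; last by rewrite src_comp.
  by rewrite deg_comp //; apply: lev_trans le (lev_addl _ _).
- by exists 0 => mu _ _; apply: ideal0.
- by apply: nullD; auto.
- by apply: nullZ; auto.
- by auto.
Qed.

Lemma act_sim t xi eta : sim xi eta -> sim (act t xi) (act t eta).
Proof.
move=> /(act_null t); congr (null _); apply/funext=> mu.
rewrite actD; congr (_ + _); rewrite -[RHS]mulN1r -actZ.
by congr (act t _ _); apply/funext=> nu; rewrite mulN1r.
Qed.

Lemma act_sum (I : Type) (r : seq I) (F : I -> kp_term K Lam) xi mu :
  act (\big[@KPadd _ _ _/@KP0 _ _ _]_(i <- r) F i) xi mu =
  \sum_(i <- r) act (F i) xi mu.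
Proof. by elim: r => [|i r IH]; rewrite ?big_nil // !big_cons /= IH. Qed.

Lemma actss' (z z' : Mor Lam) xi mu : (val z).1 = (val z').1 ->
  act (KPs K z) (act (KPs' K z') xi) mu =
  oapp (fun=> ug (hh (deg z) - hh (deg z')) * xi mu) 0 (strip (val z).1 mu).
Proof.
move=> e /=; have [[nu h [e' ->]]|[_ ->]] := stripP (val z).1 mu => //=.
by rewrite -e h eqxx mulrA ugD -e'.
Qed.

Lemma sum_strip (z : C) d mu : lev d (deg mu) ->
  \sum_(a <- paths_of_deg G d) oapp (fun=> z) 0 (strip a mu) = z.
Proof.
move=> /factor_ex[b [nu [h e db]]].
rewrite big_seq; under eq_bigr => a.
  rewrite in_paths_of_deg // => /eqP da.
  have -> : oapp (fun=> z) 0 (strip a mu) = if a == b then z else 0.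
    case: eqP => [->|ne]; first by rewrite e strip_comp.
    have [[nu' h' [e' _]]|[_ ->]] := stripP a mu => //.
    by case: ne; rewrite e in e'; case: (factor_uniq h h' e'); rewrite ?db ?da.
  over.
by rewrite -big_seq (sum_if_eq (fun=> z)) ?fset_uniq // in_paths_of_deg // db eqxx.
Qed.

Lemma act_kp4 (v : Obj Lam) n xi mu : lev (f n) (deg mu) ->
  \sum_(z <- fset_set (vpaths v n)) act (KPmul (KPs K z) (KPs' K z)) xi mu =
  if rng mu == v :> Obj G then xi mu else 0.
Proof.
move=> /factor_ex[b [nu [h e db]]]; rewrite big_seq; under eq_bigr => z.
  rewrite (in_pb_vpaths rfG) => /andP[_ /eqP dz].
  rewrite [act _ _ _]actss' // subrr ug0 mul1r.
  have -> : oapp (fun=> xi mu) 0 (strip (val z).1 mu) =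
      if z == pb_mor db then xi mu else 0.
    case: eqP => [->|ne]; first by rewrite e strip_comp.
    have [[nu' h' [e' _]]|[_ ->]] := stripP (val z).1 mu => //.
    have dz1 : deg (val z).1 = f n by rewrite (eqP (valP z)) -dz.
    rewrite e in e'; have [|e1 _] := factor_uniq h h' e'.
      by rewrite db dz1.
    case: ne; have [a0 [n0 [h0 ez]]] := pb_morP z.
    move: dz e1; rewrite ez => dz e1; apply: val_inj.
    by congr (_, _); [rewrite e1 | exact: dz].
  over.
rewrite -big_seq (sum_if_eq (fun=> xi mu)) ?fset_uniq // (in_pb_vpaths rfG).
have -> : deg (pb_mor db) == n by apply/eqP.
by rewrite andbT e rng_comp.
Qed.

Lemma act_s a n (h : deg a = f n) xi mu : act (KPs K (pb_mor h)) xi mu =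
  oapp (fun nu => ug (hh n) * xi nu) 0 (strip a mu).
Proof. by []. Qed.

Lemma act_s' a n (h : deg a = f n) xi mu : act (KPs' K (pb_mor h)) xi mu =
  if src a == rng mu then ug (- hh n) * xi (comp a mu) else 0.
Proof. by []. Qed.

Lemma act_kp_eq x y : kp_eq x y -> forall xi, sim (act x xi) (act y xi).
Proof.
elim=> {x y}.
- by move=> x xi; apply: eq_sim.
- by move=> x y _ h xi; apply: sim_sym.
- by move=> x y z _ h _ h' xi; apply: sim_trans (h xi) (h' xi).
- by move=> x x' y y' _ h _ h' xi; apply: simD.
- by move=> c x x' _ h xi /=; apply: simZ.
- by move=> x x' y y' _ h _ h' xi /=; apply: sim_trans (h _); apply: act_sim.
- by move=> x y z xi; apply: eq_sim => mu /=; rewrite addrA.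
- by move=> x y xi; apply: eq_sim => mu /=; rewrite addrC.
- by move=> x xi; apply: eq_sim => mu /=; rewrite add0r.
- by move=> b c x xi; apply: eq_sim => mu /=; rewrite mulrA kcM.
- by move=> x xi; apply: eq_sim => mu /=; rewrite kc0 mul0r.
- by move=> x xi; apply: eq_sim => mu /=; rewrite kc1 mul1r.
- by move=> c x y xi; apply: eq_sim => mu /=; rewrite mulrDr.
- by move=> b c x xi; apply: eq_sim => mu /=; rewrite kcD mulrDl.
- by move=> x y z xi; apply: eq_sim.
- by move=> x y z xi; apply: eq_sim.
- by move=> x y z xi; apply: eq_sim => mu /=; rewrite -actD.
- by move=> c x y xi; apply: eq_sim.
- by move=> c x y xi; apply: eq_sim => mu /=; rewrite -actZ.
- move=> v xi; apply: eq_sim => mu /=; rewrite hh0 ug0.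
  have [[nu h [e ->]]|[h ->]] := stripP (@idm l G v) mu => /=.
    have hv : v = rng nu by rewrite -h src_id.
    by rewrite mul1r e hv comp_idl eqxx.
  by case: eqP => // e; case: (h mu); rewrite ?src_id // -e comp_idl.
- move=> v xi; apply: eq_sim => mu /=; rewrite hh0 oppr0 ug0 mul1r.
  by rewrite [src _]src_id eq_sym; case: eqP => // <-; rewrite comp_idl.
- move=> v w xi; apply: eq_sim => mu /=; case: (v =P w) => [->|ne] /=.
    by case: ifP => // ->.
  by case: eqP => // ->; case: eqP.
- move=> z z'; have [a [n [ha ->]]] := pb_morP z.
  have [b [n' [hb ->]]] := pb_morP z'.
  move=> h0 xi; have h : src a = rng b := h0; apply: eq_sim => mu.
  have hab := pb_deg_comp2 ha hb h.
  rewrite (comp_pb_mor ha hb hab h).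
  rewrite -[LHS]/(act (KPs K (pb_mor ha)) (act (KPs K (pb_mor hb)) xi) mu).
  rewrite !act_s hhD -ugD.
  have [[nu hnu [-> ->]]|[no ->]] := stripP a mu; last first.
    rewrite strip_none // => c; rewrite src_comp // => hc e.
    by apply: (no (comp b c)); rewrite ?rng_comp // comp_assoc.
  rewrite -[LHS]/(ug (hh n) * act (KPs K (pb_mor hb)) xi nu) act_s.
  have [[nu' hnu' [e ->]]|[no ->]] := stripP b nu; last first.
    rewrite strip_none /= ?mulr0 // => c; rewrite src_comp // => hc.
    rewrite -comp_assoc // => e; apply: (no c hc).
    by have [|_ ->] := factor_uniq hnu _ e erefl; rewrite ?rng_comp.
  by rewrite e comp_assoc // strip_comp ?src_comp //= mulrA.
- move=> z z'; have [a [n [ha ->]]] := pb_morP z.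
  have [b [n' [hb ->]]] := pb_morP z'.
  move=> h0 xi; have h : src a = rng b := h0; apply: eq_sim => mu.
  have hab := pb_deg_comp2 ha hb h.
  rewrite (comp_pb_mor ha hb hab h).
  rewrite -[LHS]/(act (KPs' K (pb_mor hb)) (act (KPs' K (pb_mor ha)) xi) mu).
  rewrite !act_s' hhD src_comp //.
  case: eqP => // hmu; rewrite rng_comp // h eqxx mulrA ugD comp_assoc //.
  by rewrite opprD addrC.
- move=> z xi; apply: eq_sim => mu; have [a [n [ha ->]]] := pb_morP z.
  rewrite -[LHS]/(if rng mu == rng a then act (KPs K (pb_mor ha)) xi mu else 0).
  rewrite act_s; have [[nu h [e ->]]|[_ ->]] := stripP a mu; last by rewrite if_same.
  by rewrite e rng_comp // eqxx.
- move=> z xi; apply: eq_sim => mu; have [a [n [ha ->]]] := pb_morP z.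
  rewrite -[LHS]/(act (KPs K (pb_mor ha))
    (fun nu => if rng nu == src a then xi nu else 0) mu) !act_s.
  by have [[nu h [e ->]]|[_ ->]] := stripP a mu => //=; rewrite h eqxx.
- move=> z xi; apply: eq_sim => mu; have [a [n [ha ->]]] := pb_morP z.
  rewrite -[LHS]/(act (KPs' K (pb_mor ha))
    (fun nu => if rng nu == rng a then xi nu else 0) mu) !act_s'.
  by case: eqP => // h; rewrite rng_comp // eqxx.
- move=> z xi; apply: eq_sim => mu; have [a [n [ha ->]]] := pb_morP z.
  rewrite -[LHS]/(if rng mu == src a then act (KPs' K (pb_mor ha)) xi mu else 0).
  by rewrite act_s'; case: eqP => [->|ne]; [rewrite eqxx | case: eqP => // /esym].
- move=> z z'; have [a [n [ha ->]]] := pb_morP z.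
  have [b [n' [hb ->]]] := pb_morP z' => dz xi; apply: eq_sim => mu.
  have {dz} nn' : n = n' := dz; case: n' / nn' hb => hb.
  rewrite -[LHS]/(act (KPs' K (pb_mor ha)) (act (KPs K (pb_mor hb)) xi) mu).
  rewrite act_s' act_s.
  case: (pb_mor ha =P pb_mor hb) => [e|ne]; last first.
    case: eqP => // h; rewrite strip_none /= ?mulr0 // => c h' e; apply: ne.
    have [e1 _] := factor_uniq h h' e (etrans ha (esym hb)).
    by apply: val_inj; congr (_, _).
  have <- : a = b by case: e.
  rewrite -[RHS]/(if rng mu == src a then xi mu else 0) eq_sym.
  case: eqP => // h.
  by rewrite strip_comp //= mulrA ugD addNr ug0 mul1r.
- move=> v n n0 xi; exists (f n) => mu le _.
  by rewrite act_sum act_kp4 // subrr; apply: ideal0.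
Qed.

Definition kp_act (x : A) (xi : V) : V := act (repr (x : kp_alg K Lam)) xi.

Lemma kp_act_pi t xi : sim (kp_act (\pi_(kp_alg K Lam) t)%qT xi) (act t xi).
Proof.
apply: act_kp_eq; apply/asboolP.
rewrite -[is_true _]/(is_true (kp_equiv K Lam _ _)); apply/eqmodP.
by rewrite reprK.
Qed.

Lemma kp_actD (x y : A) xi :
  sim (kp_act (x + y) xi) (fun mu => kp_act x xi mu + kp_act y xi mu).
Proof. exact: kp_act_pi. Qed.

Lemma kp_actM (x y : A) xi : sim (kp_act (x * y) xi) (kp_act x (kp_act y xi)).
Proof. exact: kp_act_pi. Qed.

Lemma kp_actZ (e : K) (x : A) xi :
  sim (kp_act (e *: x) xi) (fun mu => kc e * kp_act x xi mu).
Proof. exact: kp_act_pi. Qed.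

Lemma kp_act0 xi : sim (kp_act 0 xi) (fun=> 0).
Proof. exact: kp_act_pi. Qed.

Lemma kp_act_p v xi :
  sim (kp_act (p v) xi) (fun mu => if rng mu == v then xi mu else 0).
Proof. exact: kp_act_pi. Qed.

Lemma kp_act_sum (I : Type) (r : seq I) (F : I -> A) xi :
  sim (kp_act (\sum_(i <- r) F i) xi) (fun mu => \sum_(i <- r) kp_act (F i) xi mu).
Proof.
elim: r => [|i r IH].
  rewrite big_nil; apply: sim_trans (kp_act0 xi) _.
  by apply: eq_sim => mu; rewrite big_nil.
rewrite big_cons; apply: sim_trans (kp_actD _ _ xi) _.
apply: (sim_trans (eta := fun mu => kp_act (F i) xi mu +
  \sum_(j <- r) kp_act (F j) xi mu)); first by apply: simD => //; apply: eq_sim.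
by apply: eq_sim => mu; rewrite big_cons.
Qed.

Lemma sim_sum (I : eqType) (r : seq I) (F F' : I -> V) :
  (forall i, i \in r -> sim (F i) (F' i)) ->
  sim (fun mu => \sum_(i <- r) F i mu) (fun mu => \sum_(i <- r) F' i mu).
Proof.
elim: r => [|i r IH] h; first by apply: eq_sim => mu; rewrite !big_nil.
have [e e'] : (fun mu => \sum_(j <- i :: r) F j mu) =
     (fun mu => F i mu + \sum_(j <- r) F j mu) /\
   (fun mu => \sum_(j <- i :: r) F' j mu) =
     (fun mu => F' i mu + \sum_(j <- r) F' j mu).
  by split; apply/funext=> mu; rewrite big_cons.
rewrite e e'; apply: simD; first by apply: h; rewrite inE eqxx.
by apply: IH => j jr; apply: h; rewrite inE jr orbT.
Qed.

Lemma kp_act_U h xi : sim (kp_act (pb_U K finG h) xi) (fun mu => ug h * xi mu).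
Proof.
rewrite pb_UE //; set n := posv _; set n' := negv _.
have nn' : f n = f n' by apply: kerf_pos_neg.
have hE : hh n - hh n' = h.
  apply: val_inj; rewrite raddfB /= [in RHS](posvK (val h)) -/n -/n' nn'.
  by rewrite opprB addrA subrK.
apply: sim_trans (kp_act_sum _ _ _) _.
apply: (sim_trans (eta := fun mu => \sum_(a <- paths_of_deg G (f n))
   oapp (fun=> ug h * xi mu) 0 (strip a mu))); last first.
  exists (f n) => mu le _; rewrite (sum_strip (ug h * xi mu) le) subrr.
  exact: ideal0.
apply: sim_sum => a; rewrite in_paths_of_deg // => /eqP da.
have da' : deg a = f n' by rewrite -nn'.
rewrite (pb_sE K finG da) (pb_s'E K finG da').
apply: sim_trans (kp_actM _ _ _) _.
apply: (sim_trans (eta := act (KPs K (pb_mor da)) (act (KPs' K (pb_mor da')) xi))).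
  apply: sim_trans (kp_act_pi (KPs K (pb_mor da)) _) _.
  by apply: act_sim; apply: kp_act_pi.
by apply: eq_sim => mu; rewrite -hE; apply: (@actss' (pb_mor da) (pb_mor da')).
Qed.

Definition kills (x : A) : Prop := forall xi, null (kp_act x xi).

Lemma kills_ideal : ideal (kills : set A).
Proof.
split.
- by move=> xi; apply: null_sim (kp_act0 xi) _; exists 0 => *; apply: ideal0.
- by move=> x y hx hy xi; apply: null_sim (kp_actD x y xi) _; apply: nullD.
- move=> a x hx; split=> xi; apply: null_sim (kp_actM _ _ xi) _; last exact: hx.
  exact: act_null.
Qed.

End Representation.

Section TailRepresentation.
Context (K : fieldType) (k l : nat) (f : {additive natv k -> natv l}).
Context (G : kgraph l) (rfG : row_finite G) (finG : finite_vertices G).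
Context (g : natv l -> natv k) (g0 : g 0 = 0).
Context (gD : {morph g : m n / m + n}) (fg : forall n, f (g n) = n).

Local Notation Lam := (pullback f G).
Local Notation A := (KP K Lam finG).
Local Notation C := (galg K (kerf f)).
Local Notation p := (pb_p K f finG).
Local Notation io := (iota finG : C -> A).
Local Notation ug := (@ug K k l f).

Context (T : MT G) (m : set C) (im : ideal m).

Implicit Types (v : Obj G) (c : C) (xi : Mor G -> C).

Definition kc (x : K) : C := << x *g 0 >>.

Lemma galgUM (x y : K) (h h' : kerf f) :
  (<< x *g h >> : C) * (<< y *g h' >> : C) = << x * y *g h + h' >>.
Proof.
rewrite [LHS]/(galg_mul _ _) /galg_mul !msuppU.
have [->|x0] := eqVneq x 0; first by rewrite big_seq_fset0 mul0r monalgU0.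
rewrite big_seq_fset1; have [->|y0] := eqVneq y 0.
  by rewrite big_seq_fset0 mulr0 monalgU0.
by rewrite big_seq_fset1 !mcoeffUU.
Qed.

Lemma ugD h h' : ug h * ug h' = ug (h + h').
Proof. by rewrite galgUM mulr1. Qed.
Lemma ug0 : ug 0 = 1. Proof. by []. Qed.
Lemma kcM x y : kc x * kc y = kc (x * y).
Proof. by rewrite galgUM addr0. Qed.
Lemma kcD x y : kc (x + y) = kc x + kc y.
Proof. exact: monalgUD. Qed.
Lemma kc0 : kc 0 = 0.
Proof. exact: monalgU0. Qed.
Lemma kc1 : kc 1 = 1. Proof. by []. Qed.

Local Notation act := (act fg kc ug).
Local Notation kp_act := (@kp_act K k l f G finG g fg C kc ug).
Local Notation null := (null T m).
Local Notation sim := (sim T m).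
Let simT := @sim_trans l G C T m im.
Local Notation kills := (@kills K k l f G finG g fg C kc ug T m).

Let act_sumE := @kp_act_sum K k l f G rfG finG g g0 gD fg C kc ug
  kcM kc0 kcD kc1 ugD ug0 T m im.
Let actM := @kp_actM K k l f G rfG finG g g0 gD fg C kc ug
  kcM kc0 kcD kc1 ugD ug0 T m im.
Let actZ := @kp_actZ K k l f G rfG finG g g0 gD fg C kc ug
  kcM kc0 kcD kc1 ugD ug0 T m im.
Let act_p := @kp_act_p K k l f G rfG finG g g0 gD fg C kc ug
  kcM kc0 kcD kc1 ugD ug0 T m im.
Let act_U := @kp_act_U K k l f G rfG finG g g0 gD fg C kc ug
  kcM kc0 kcD kc1 ugD ug0 T m im.
Let kI := @kills_ideal K k l f G rfG finG g g0 gD fg C kc ug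
  kcM kc0 kcD kc1 ugD ug0 T m im.

Lemma kp_act_iota c xi : sim (kp_act (io c) xi) (fun mu => c * xi mu).
Proof.
rewrite /iota; apply: simT (act_sumE _ _ _) _.
have -> : (fun mu => c * xi mu) =
    (fun mu => \sum_(h <- msupp c) kc c@_h * (ug h * xi mu)).
  apply/funext=> mu; rewrite {1}(galgUE c) mulr_suml; apply: eq_bigr => h _.
  have -> : << c@_h *g h >> = kc c@_h * ug h by rewrite [RHS]galgUM mulr1 add0r.
  exact: esym (mulrA _ _ _).
apply: (sim_sum im) => h _; apply: simT (actZ _ _ _) _.
by apply: (simZ im); apply: act_U.
Qed.

Lemma tail_ideal_kills : (tail_ideal T m : set A) `<=` kills.
Proof.
apply: tail_ideal_min; first exact: kI.
- move=> v nTv xi; apply: (null_sim im) (act_p v xi) _.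
  exists 0 => mu _ Tmu; case: eqP => e; last exact: ideal0 im.
  by case: nTv; rewrite -e; apply: mt_upward Tmu _; exists mu.
- move=> c mc xi; apply: (null_sim im) (kp_act_iota c xi) _.
  by exists 0 => mu _ _; apply: idealMr.
Qed.

(** The constant function 1 detects [p v * iota c]. *)
Lemma kills_p_iota v c : val T v -> kills (p v * io c) -> m c.
Proof.
move=> Tv /(_ (fun=> 1)) h.
have [N hN] : null (fun mu => if rng mu == v then c * 1 else 0).
  apply: (null_sim im) h; apply: (sim_sym im); apply: simT (actM _ _ _) _.
  apply: simT (act_p v _) _.
  exact: (act_sim fg kc ug im (KPp K (v : Obj Lam)) (kp_act_iota c (fun=> 1))).
have [_ _ mt2 _] := set_mem (valP T).
have [a [ra da] Ta] := mt2 v N Tv.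
by have := hN a; rewrite da ra eqxx mulr1; apply=> //; apply: lev_refl.
Qed.

End TailRepresentation.


Lemma tail_ideal_p_iota (K : fieldType) (k l : nat)
    (f : {additive natv k -> natv l})
    (f_surj : forall n : natv l, exists m : natv k, f m = n)
    (G : kgraph l) (rfG : row_finite G) (finG : finite_vertices G)
    (T : MT G) (m : set (galg K (kerf f))) v c : ideal m ->
  tail_ideal T m (pb_p K f finG v * iota finG c) <-> ~ val T v \/ m c.
Proof.
move=> im; have iQ := tail_ideal_ideal rfG finG T m.
split=> [h|[nTv|mc]].
- have [Tv|] := pselect (val T v); last by left.
  right; have [g [g0 gD fg]] := degree_section f_surj.
  have := @tail_ideal_kills K k l f G rfG finG g g0 gD fg T m im _ h.
  exact: (@kills_p_iota K k l f G rfG finG g g0 gD fg T m im v c Tv).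
- by apply: (idealMr _ iQ); apply: tail_ideal_p.
- by apply: (idealMl _ iQ); apply: tail_ideal_iota.
Qed.


(** * Primitive ideals from idempotents *)

Section LeftIdeals.
Context (R : pzRingType).

Definition left_ideal (N : set R) : Prop :=
  [/\ N 0, forall x y, N x -> N y -> N (x + y) & forall a x, N x -> N (a * x)].

Lemma maximal_left_ideal_ex (L : set R) : left_ideal L -> ~ L 1 ->
  exists N, [/\ left_ideal N, L `<=` N, ~ N 1 &
    forall N', left_ideal N' -> N `<=` N' -> ~ N' 1 -> N' `<=` N].
Proof.
move=> lL L1.
(* The empty set is the union of the empty chain. *)
pose P (X : set R) := X = set0 \/ [/\ left_ideal X, L `<=` X & ~ X 1].
have [|N [PN maxN]] := @Zorn_bigcup R P.
  move=> F FP totF.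
  have [[X0 FX0 nX0]|noX] := pselect (exists2 X, F X & X <> set0); last first.
    left; apply/seteqP; split=> // x [X FX Xx].
    by case: noX; exists X => // e; rewrite e in Xx.
  have FP' X : F X -> X !=set0 -> [/\ left_ideal X, L `<=` X & ~ X 1].
    by move=> /FP[->|//] [].
  have [[X00 _ _] LX0 _] : [/\ left_ideal X0, L `<=` X0 & ~ X0 1].
    by apply: FP' => //; apply/set0P/eqP.
  right; split; last by move=> [X FX X1]; have [] := FP' X FX (ex_intro _ _ X1).
    split; first by exists X0.
      move=> x y [X FX Xx] [Y FY Yy].
      have [[_ XD _] _ _] := FP' X FX (ex_intro _ _ Xx).
      have [[_ YD _] _ _] := FP' Y FY (ex_intro _ _ Yy).
      have [XY|YX] := totF X Y FX FY.
        by exists Y => //; apply: YD => //; apply: XY.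
      by exists X => //; apply: XD => //; apply: YX.
    move=> a x [X FX Xx]; exists X => //.
    by have [[_ _ h] _ _] := FP' X FX (ex_intro _ _ Xx); apply: h.
  by move=> x Lx; exists X0 => //; apply: LX0.
have L0 : L 0 by case: lL.
case: PN => [N0|[lN LN N1]].
  exfalso; apply: (maxN L); last by right; split.
  by rewrite N0; split=> // /(_ 0 L0).
exists N; split=> // N' lN' NN' N'1; apply: contrapT => nN'.
apply: (maxN N'); first by split.
by right; split=> //; apply: subset_trans NN'.
Qed.

End LeftIdeals.

Section CyclicModule.
Context (R : pzRingType) (N : set R) (lN : left_ideal N).

Definition left_pred : {pred R} := fun x => `[< N x >].

Fact left_pred_zmod_closed : zmod_closed left_pred.
Proof.
have [N0 ND NM] := lN; split; first exact/asboolP.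
move=> x y /asboolP Nx /asboolP Ny; apply/asboolP; apply: ND => //.
by rewrite -mulN1r; apply: NM.
Qed.
HB.instance Definition _ :=
  GRing.isZmodClosed.Build R left_pred left_pred_zmod_closed.

Definition cyclic_module : Type := Quotient.quot left_pred.
HB.instance Definition _ := Choice.on cyclic_module.
HB.instance Definition _ := GRing.Zmodule.on cyclic_module.

Definition cyclic_pi (x : R) : cyclic_module := (\pi_(Quotient.quot left_pred) x)%qT.

Lemma cyclic_piP x y : cyclic_pi x = cyclic_pi y <-> N (x - y).
Proof.
split=> [/eqP|h]; last first.
  by apply/eqP; rewrite -(Quotient.idealrBE left_pred); apply/asboolP.
by rewrite -(Quotient.idealrBE left_pred) => /asboolP.
Qed.

Lemma cyclic_piK (u : cyclic_module) : cyclic_pi (repr (u : Quotient.quot left_pred)) = u.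
Proof. exact: reprK. Qed.

Lemma cyclic_piD x y : cyclic_pi (x + y) = cyclic_pi x + cyclic_pi y.
Proof. exact: (raddfD (\pi_(Quotient.quot left_pred))%qT). Qed.

Definition cyclic_scale (a : R) (u : cyclic_module) : cyclic_module :=
  cyclic_pi (a * repr (u : Quotient.quot left_pred)).

Lemma cyclic_scale_pi a x : cyclic_scale a (cyclic_pi x) = cyclic_pi (a * x).
Proof.
apply/cyclic_piP; rewrite -mulrBr; have [_ _ NM] := lN; apply: NM.
by apply/cyclic_piP; rewrite cyclic_piK.
Qed.

Lemma cyclic_ind (P : cyclic_module -> Prop) : (forall x, P (cyclic_pi x)) -> forall u, P u.
Proof. by move=> h u; rewrite -(cyclic_piK u). Qed.

Fact cyclic_scaleA a b u : cyclic_scale a (cyclic_scale b u) = cyclic_scale (a * b) u.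
Proof. by elim/cyclic_ind: u => x; rewrite !cyclic_scale_pi mulrA. Qed.
Fact cyclic_scale1 : left_id 1 cyclic_scale.
Proof. by elim/cyclic_ind=> x; rewrite cyclic_scale_pi mul1r. Qed.
Fact cyclic_scaleDr : right_distributive cyclic_scale +%R.
Proof.
move=> a; elim/cyclic_ind=> x; elim/cyclic_ind=> y.
by rewrite -cyclic_piD !cyclic_scale_pi -cyclic_piD mulrDr.
Qed.
Fact cyclic_scaleDl u : {morph cyclic_scale^~ u : a b / a + b}.
Proof.
by elim/cyclic_ind: u => x a b; rewrite !cyclic_scale_pi -cyclic_piD mulrDl.
Qed.
HB.instance Definition _ := GRing.Zmodule_isLmodule.Build R cyclic_module
  cyclic_scaleA cyclic_scale1 cyclic_scaleDr cyclic_scaleDl.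

Lemma cyclic_scaleE a x : a *: cyclic_pi x = cyclic_pi (a * x).
Proof. exact: cyclic_scale_pi. Qed.

Lemma cyclic_pi0P x : cyclic_pi x = 0 <-> N x.
Proof.
have e0 : cyclic_pi 0 = 0 by exact: (raddf0 (\pi_(Quotient.quot left_pred))%qT).
by rewrite -e0 cyclic_piP subr0.
Qed.

Lemma cyclic_module_simple : ~ N 1 ->
  (forall N', left_ideal N' -> N `<=` N' -> ~ N' 1 -> N' `<=` N) ->
  simple_module cyclic_module.
Proof.
move=> N1 maxN; split; first by exists (cyclic_pi 1) => /cyclic_pi0P.
move=> S [S0 SD SZ]; pose N' := [set x | S (cyclic_pi x)].
have lN' : left_ideal N'.
  split; first by rewrite /N' /= (_ : cyclic_pi 0 = 0) //; apply/cyclic_pi0P; case: lN.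
    by move=> x y; rewrite /N' /= cyclic_piD; apply: SD.
  by move=> a x; rewrite /N' /= -cyclic_scaleE; apply: SZ.
have NN' : N `<=` N' by move=> x /cyclic_pi0P; rewrite /N' /= => ->.
have [S1|nS1] := pselect (N' 1).
  right; apply/seteqP; split=> // u _; elim/cyclic_ind: u => x.
  by have := SZ x _ S1; rewrite cyclic_scaleE mulr1.
left; apply/seteqP; split=> [u|u -> //]; elim/cyclic_ind: u => x Sx.
by apply/cyclic_pi0P; apply: (maxN N').
Qed.

End CyclicModule.

(** A nonzero idempotent is never in the Jacobson radical, here that of [R / P]:
  a maximal left ideal that contains [P] and [1 - e] cannot contain [e]. *)
Lemma simple_module_idempotent (R : pzRingType) (P : set R) (e : R) :
  ideal P -> e * e = e -> ~ P e ->
  exists M : lmodType R, [/\ simple_module M, P `<=` annihilator M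
    & ~ annihilator M e].
Proof.
move=> iP ee nPe.
(* This is [P + R (1 - e)]. *)
pose L := [set x | P (x * e)].
have lL : left_ideal L.
  split=> [|x y|a x]; rewrite /L /= ?mul0r ?mulrDl -?mulrA; first exact: ideal0.
    exact: idealD.
  exact: idealMl.
have L1 : ~ L 1 by rewrite /L /= mul1r.
have [N [lN LN N1 maxN]] := maximal_left_ideal_ex lL L1.
exists (cyclic_module lN); split; first exact: cyclic_module_simple.
  move=> a Pa u; elim/cyclic_ind: u => x; rewrite cyclic_scaleE.
  by apply/cyclic_pi0P; apply: LN; rewrite /L /= -mulrA; apply: idealMr.
move=> /(_ (cyclic_pi lN 1)); rewrite cyclic_scaleE mulr1 => /cyclic_pi0P Ne.
apply: N1; rewrite -(subrK e 1); have [_ ND _] := lN; apply: ND => //.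
by apply: LN; rewrite /L /= mulrBl mul1r ee subrr; apply: ideal0.
Qed.

(** * Central characters of simple modules *)

Section SimpleModules.
Context (R : pzRingType) (M : lmodType R) (sM : simple_module M).
Implicit Types (z : R) (u : M).

Lemma simple_cyclic u : u <> 0 -> forall w, exists a : R, w = a *: u.
Proof.
move=> nu w; pose N := [set w : M | exists a : R, w = a *: u].
have sN : submodule N.
  split; first by exists 0; rewrite scale0r.
    by move=> _ _ [a ->] [b ->]; exists (a + b); rewrite scalerDl.
  by move=> b _ [a ->]; exists (b * a); rewrite scalerA.
have [_ h] := sM; have [e|e] := h N sN; last by have : N w by rewrite e.
case: nu; have : N u by exists 1; rewrite scale1r.
by rewrite e.
Qed.

(** Schur's lemma: multiplication by a central element is an endomorphism. *)
Lemma simple_central z : (forall a, z * a = a * z) -> ~ annihilator M z ->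
  (forall u, z *: u = 0 -> u = 0) /\ (forall w, exists u, z *: u = w).
Proof.
move=> cz /existsNP[u0 nu0]; split.
  move=> u zu; apply: contrapT => /simple_cyclic/(_ u0)[a e].
  by apply: nu0; rewrite e scalerA cz -scalerA zu scaler0.
move=> w; have [a ->] := simple_cyclic nu0 w.
by exists (a *: u0); rewrite !scalerA cz.
Qed.

End SimpleModules.

Lemma maximal_ideal_inv (C : comPzRingType) (m : set C) (c : C) :
  maximal_ideal m -> ~ m c -> exists d, m (1 - c * d).
Proof.
move=> [im pm mm] nc; pose J := [set x | exists d, m (x - c * d)].
have iJ : ideal J.
  split; first by exists 0; rewrite mulr0 subr0; apply: ideal0.
    move=> x y [d hx] [d' hy]; exists (d + d').
    by rewrite mulrDr opprD addrACA; apply: idealD.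
  move=> a x [d hx]; have h : J (a * x).
    by exists (a * d); rewrite mulrCA -mulrBr; apply: idealMl.
  by split=> //; rewrite mulrC.
have [|e|e] := mm J iJ.
- by move=> x mx; exists 0; rewrite mulr0 subr0.
- by case: nc; rewrite -e; exists 1; rewrite mulr1 subrr; apply: ideal0.
- by have : J 1 by rewrite e.
Qed.

Section CountableSpan.
Context (K : fieldType) (k l : nat) (f : {additive natv k -> natv l}).
Context (G : kgraph l) (finG : finite_vertices G).

Local Notation Lam := (pullback f G).
Local Notation A := (KP K Lam finG).

Let word := seq (Obj Lam + (Mor Lam + Mor Lam)).

Definition word_value (w : word) : A := \prod_(y <- w)
  (match y with
  | inl v => kp_p K v | inr (inl z) => kp_s K z | inr (inr z) => kp_s' K z
  end : A).

Let in_span (x : A) := exists r : seq (K * word),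
  x = \sum_(y <- r) y.1 *: word_value y.2.

Let in_span_word w : in_span (word_value w).
Proof. by exists [:: (1, w)]; rewrite big_seq1 scale1r. Qed.

Let in_spanD x y : in_span x -> in_span y -> in_span (x + y).
Proof. by move=> [r ->] [r' ->]; exists (r ++ r'); rewrite big_cat. Qed.

Let in_spanZ c x : in_span x -> in_span (c *: x).
Proof.
move=> [r ->]; exists [seq (c * y.1, y.2) | y <- r].
by rewrite big_map scaler_sumr; apply: eq_bigr => y _; rewrite scalerA.
Qed.

Let in_span0 : in_span 0.
Proof. by exists [::]; rewrite big_nil. Qed.

Let in_spanM x y : in_span x -> in_span y -> in_span (x * y).
Proof.
move=> [r ->] [r' ->]; rewrite mulr_suml; elim/big_ind: _ => // a _.
rewrite mulr_sumr; elim/big_ind: _ => // b _.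
rewrite pb_scalerAl pb_scalerAr; do 2!apply: in_spanZ.
by rewrite /word_value -big_cat; apply: in_span_word.
Qed.

Let in_spanT x : in_span x.
Proof.
elim/kp_piW: x; elim=> [v|z|z||x IHx y IHy|c x IHx|x IHx y IHy].
- by have := in_span_word [:: inl v]; rewrite /word_value big_seq1.
- by have := in_span_word [:: inr (inl z)]; rewrite /word_value big_seq1.
- by have := in_span_word [:: inr (inr z)]; rewrite /word_value big_seq1.
- exact: in_span0.
- by rewrite kp_piD; apply: in_spanD.
- by rewrite kp_piZ; apply: in_spanZ.
- by rewrite kp_pi_mul; apply: in_spanM.
Qed.

Lemma kp_countable_span : exists e : nat -> A, forall x, exists n (c : nat -> K),
  x = \sum_(i < n) c i *: e i.
Proof.
pose e i := oapp word_value 0 (choice.unpickle i); exists e => x.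
have [r ->] := in_spanT x; elim: r => [|[c w] r [n [d hd]]].
  by exists 0%N, (fun=> 0); rewrite big_nil big_ord0.
pose N := maxn n (choice.pickle w).+1.
exists N, (fun i => (if (i < n)%N then d i else 0) + (if i == choice.pickle w then c else 0)).
rewrite big_cons hd /=; under [RHS]eq_bigr do rewrite scalerDl.
rewrite big_split /= addrC; congr (_ + _); last first.
  apply: etrans (big_ord_widen N (fun i => d i *: e i) (leq_maxl _ _)) _.
  by rewrite big_mkcond; apply: eq_bigr => i _; case: ifP => _; rewrite ?scale0r.
have wN : (choice.pickle w < N)%N by rewrite leq_max leqnn orbT.
rewrite (bigD1 (Ordinal wN)) //= eqxx big1 ?addr0 => [|i].
  by rewrite /e choice.pickleK.
by rewrite -val_eqE /= => /negPf ->; rewrite scale0r.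
Qed.

End CountableSpan.

Lemma linear_dependence (K : fieldType) (n : nat) (c : 'I_n.+1 -> 'I_n -> K) :
  exists v : 'I_n.+1 -> K, (exists j, v j != 0) /\
    forall i, \sum_j v j * c j i = 0.
Proof.
pose X := \matrix_(j < n.+1, i < n) c j i.
have nk : kermx X != 0.
  rewrite kermx_eq0 /row_free; apply/negP => /eqP e.
  by have := rank_leq_col X; rewrite e ltnn.
pose v := nz_row (kermx X); exists (fun j => v 0 j); split.
  have /rV0Pn[j hj] : v != 0 by rewrite nz_row_eq0.
  by exists j.
have /sub_kermxP/matrixP vX : (v <= kermx X)%MS by exact: nz_row_sub.
move=> i; have := vX 0 i; rewrite mxE [RHS]mxE => h.
by rewrite -[RHS]h; apply: eq_bigr => j _; rewrite [X _ _]mxE.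
Qed.

Lemma closed_field_splits (K : fieldType) (q : {poly K}) :
  GRing.closed_field_axiom K ->
  exists r : seq K, q = lead_coef q *: \prod_(z <- r) ('X - z%:P).
Proof.
move=> acK; have [n le_q] := ubnP (size q); elim: n q le_q => // n IH q le_q.
have [le1|lt1] := leqP (size q) 1.
  exists [::]; rewrite big_nil {1}(size1_polyC le1) lead_coefE alg_polyC.
  by congr _%:P; case: (size q) le1 => [|[]].
have lc0 : lead_coef q != 0 by rewrite lead_coef_eq0 -size_poly_gt0 ltnW.
have [|x hx] := acK (size q).-1 (fun i => - (q`_i / lead_coef q)).
  by rewrite -subn1 subn_gt0.
have rx : root q x.
  apply/rootP; rewrite horner_coef -(prednK (ltnW lt1)) big_ord_recr /= hx.
  rewrite mulr_sumr -big_split big1 //= => i _.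
  by rewrite -lead_coefE mulNr mulrN mulrA mulrCA divff // mulr1 subrr.
have [q' qE] := factor_theorem q x rx.
have q'0 : q' != 0.
  by apply: contraNneq lc0 => q'0; rewrite qE q'0 mul0r lead_coef0.
have [|r hr] := IH q'.
  by move: le_q; rewrite qE size_Mmonic ?monicXsubC // size_XsubC addn2.
exists (x :: r); rewrite big_cons {1}qE {1}hr qE lead_coefM lead_coefXsubC mulr1.
by rewrite -scalerAl mulrC.
Qed.

Section Amitsur.
Context (K : fieldType) (k l : nat) (f : {additive natv k -> natv l}).
Context (G : kgraph l) (finG : finite_vertices G).

Local Notation Lam := (pullback f G).
Local Notation A := (KP K Lam finG).

Context (C : comNzRingType) (kc : {rmorphism K -> C}) (io : {rmorphism C -> A}).
Context (cen : forall c x, io c * x = x * io c).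
Context (io_kc : forall x, io (kc x) = x *: (1 : A)).
Context (unK : ~ countable [set: K]) (acK : GRing.closed_field_axiom K).
Context (M : lmodType A) (sM : simple_module M).

(** Amitsur's argument: were [c - x] invertible on [M] for all the uncountably
  many scalars [x], the inverses applied to one vector would lie in a space of
  countable dimension, hence satisfy a linear relation; clearing denominators,
  a nonzero polynomial in [c], which is a product of factors [c - x], would
  kill that vector. *)
Lemma central_character (c : C) : exists x : K, annihilator M (io (c - kc x)).
Proof.
apply: contrapT => /forallNP nz.
have inj x (u : M) : io (c - kc x) *: u = 0 -> u = 0.
  exact: (simple_central sM (cen _) (nz x)).1.
have [[u0 nu0] _] := sM.
have wex x : exists a, io (c - kc x) *: (a *: u0) = u0.
  have [u hu] := (simple_central sM (cen _) (nz x)).2 u0.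
  by have [a e] := simple_cyclic sM nu0 u; exists a; rewrite -e.
have [a ha] := choice wex.
have [e he] := kp_countable_span K f finG.
have /choice[nn /choice[cc hcc]] : forall x, exists n, exists d : nat -> K,
  a x = \sum_(i < n) d i *: e i by move=> x; apply: he.
(* Infinitely many scalars share the length [n] of their expansion, and [n.+1]
  of them give a linear relation. *)
have [n infn] : exists n, infinite_set [set x | nn x = n].
  apply: contrapT => /forallNP fin; apply: unK.
  have -> : [set: K] = \bigcup_n [set x | nn x = n].
    by apply/seteqP; split=> // x _; exists (nn x).
  by apply: bigcup_countable => // n _; apply: finite_set_countable; apply: contrapT (fin n).
have [B BS leB] := infinite_set_fset n.+1 infn.
pose lam (j : 'I_n.+1) := nth 0 B j.
have ltB (j : 'I_n.+1) : (j < size B)%N by exact: leq_trans (ltn_ord j) leB.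
have lamn j : nn (lam j) = n by apply: BS => /=; apply: mem_nth.
have lamI : injective lam.
  by move=> i j /eqP; rewrite nth_uniq ?fset_uniq // => /eqP; apply: val_inj.
have [v [[j0 vj0] hv]] := linear_dependence (fun j i => cc (lam j) i).
have rel : \sum_j v j *: a (lam j) = 0.
  have eq_a j : a (lam j) = \sum_(i < n) cc (lam j) i *: e i.
    by rewrite hcc lamn.
  under eq_bigr do rewrite eq_a scaler_sumr.
  rewrite exchange_big big1 // => i _.
  under eq_bigr do rewrite scalerA.
  by rewrite -scaler_suml hv scale0r.
(* The relation with its denominators cleared. *)
pose q : {poly K} := \sum_j v j *: \prod_(i | i != j) ('X - (lam i)%:P).
(* The value of [q] at [lam j] is a nonzero multiple of [v j]. *)
have q0 : q != 0.
  apply/eqP => /(congr1 (fun r => r.[lam j0])); rewrite horner0 horner_sum.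
  rewrite (bigD1 j0) //= [X in _ + X]big1 ?addr0 => [|j jj0]; last first.
    rewrite hornerZ horner_prod (bigD1 j0) 1?eq_sym //= hornerXsubC subrr.
    by rewrite mul0r mulr0.
  rewrite hornerZ horner_prod => /eqP; rewrite mulf_eq0 (negPf vj0) /=.
  apply/negP/prodf_neq0 => i ij0; rewrite hornerXsubC subr_eq0.
  by apply: contra ij0 => /eqP/lamI ->.
have qc : (map_poly kc q).[c] =
    \sum_j kc (v j) * \prod_(i | i != j) (c - kc (lam i)).
  rewrite rmorph_sum horner_sum; apply: eq_bigr => j _.
  rewrite /= map_polyZ hornerZ rmorph_prod horner_prod; congr (_ * _).
  by apply: eq_bigr => i _; rewrite /= map_polyXsubC hornerXsubC.
have qu0 : io (map_poly kc q).[c] *: u0 = 0.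
  pose D := \prod_i (c - kc (lam i)).
  have -> : io (map_poly kc q).[c] *: u0 = io D *: ((\sum_j v j *: a (lam j)) *: u0).
    rewrite qc rmorph_sum [LHS]scaler_suml [X in _ = _ *: X]scaler_suml.
    rewrite [RHS]scaler_sumr; apply: eq_bigr => j _.
    have -> : D = \prod_(i | i != j) (c - kc (lam i)) * (c - kc (lam j)).
      by rewrite /D (bigD1 j) //= mulrC.
    rewrite !rmorphM io_kc.
    rewrite -[in LHS](ha (lam j)) !scalerA; congr (_ *: _).
    by rewrite !pb_scalerAl mul1r pb_scalerAr.
  by rewrite rel scale0r scaler0.
have [r qr] := closed_field_splits q acK.
have qcr : (map_poly kc q).[c] = kc (lead_coef q) * \prod_(z <- r) (c - kc z).
  rewrite {1}qr map_polyZ hornerZ rmorph_prod horner_prod; congr (_ * _).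
  by apply: eq_bigr => z _; rewrite /= map_polyXsubC hornerXsubC.
have injr s (u : M) : io (\prod_(z <- s) (c - kc z)) *: u = 0 -> u = 0.
  elim: s => [|z s IH]; first by rewrite big_nil rmorph1 scale1r.
  by rewrite big_cons rmorphM -scalerA => /inj/IH.
apply: nu0; apply: (injr r).
have : io (kc (lead_coef q)^-1) *: (io (map_poly kc q).[c] *: u0) = 0.
  by rewrite qu0 scaler0.
by rewrite qcr scalerA -rmorphM mulrA -rmorphM mulVf ?lead_coef_eq0 // rmorph1 mul1r.
Qed.

End Amitsur.

(** * The primitive ideals attached to tails *)

Section TailPrimitive.
Context (K : fieldType) (k l : nat) (f : {additive natv k -> natv l}).
Context (f_surj : forall n : natv l, exists m : natv k, f m = n).
Context (G : kgraph l) (rfG : row_finite G) (finG : finite_vertices G).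
Context (sapG : strongly_aperiodic G).

Local Notation Lam := (pullback f G).
Local Notation A := (KP K Lam finG).
Local Notation C := (galg K (kerf f)).
Local Notation p := (pb_p K f finG).
Local Notation io := (iota finG : C -> A).

Implicit Types (T : MT G) (m : set C) (v w : Obj G) (c d : C).

(** The tail is finite, and (MT3) says that it is directed. *)
Lemma mt_root T : exists2 z, val T z & forall v, val T v -> reach v z.
Proof.
have [[v0 Tv0] _ _ mt3] := set_mem (valP T).
have finT : finite_set (val T) by apply: sub_finite_set finG.
have ub (r : seq (Obj G)) : (forall v, v \in r -> val T v) ->
    exists2 z, val T z & forall v, v \in r -> reach v z.
  elim: r => [|v r IH] sub; first by exists v0.
  have [|z Tz hz] := IH; first by move=> w wr; apply: sub; rewrite inE wr orbT.
  have Tv : val T v by apply: sub; rewrite inE eqxx.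
  have [y [Ty vy zy]] := mt3 v z Tv Tz.
  exists y => // w; rewrite inE => /orP[/eqP -> //|/hz wz].
  exact: reach_trans wz zy.
have [|z Tz hz] := ub (fset_set (val T)).
  by move=> v vT; apply: set_mem; rewrite -(in_fset_set finT); apply: vT.
exists z => // v Tv; apply: hz.
by have : v \in fset_set (val T) by rewrite in_fset_set // mem_set.
Qed.

Lemma ideal_p_reach (I : set A) v w : ideal I -> reach v w -> I (p v) -> I (p w).
Proof.
move=> iI [a [<- <-]] Iv; have [n dn] := f_surj (deg a).
have <- : pb_s' K f finG a n * pb_s K f finG a n = p (src a).
  by rewrite pb_s'Ms // eqxx.
rewrite -(pb_ps K f finG a) mulrA; apply: (idealMr _ iI).
exact: (idealMl _ iI).
Qed.

(** Modulo an ideal that contains [iota m], the elements outside [m] are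
  invertible. *)
Lemma ideal_p_iota_inv (I : set A) m v c : ideal I -> maximal_ideal m ->
  (forall d, m d -> I (io d)) -> ~ m c -> I (p v * io c) -> I (p v).
Proof.
move=> iI mm mI nc h; have [d hd] := maximal_ideal_inv mm nc.
have -> : p v = p v * io c * io d + p v * io (1 - c * d).
  by rewrite -mulrA -iotaM // -mulrDr -iotaD addrC subrK iota1 // mulr1.
apply: (idealD iI); first exact: (idealMr _ iI).
by apply: (idealMl _ iI); apply: mI.
Qed.

Lemma tail_ideal_p_notin T m v : maximal_ideal m -> val T v ->
  ~ (tail_ideal T m : set A) (p v).
Proof.
move=> [im /(ideal_proper im) m1 _] Tv h.
have : tail_ideal T m (p v * io 1) by rewrite iota1 // mulr1.
by case/(tail_ideal_p_iota f_surj rfG finG T v 1 im).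
Qed.

Lemma tail_ideal_primitive T m : maximal_ideal m ->
  primitive_ideal (tail_ideal T m : set A).
Proof.
move=> mm; have im : ideal m by case: mm.
have [z Tz hz] := mt_root T.
have iQ := tail_ideal_ideal rfG finG T m.
have pp : p z * p z = p z by rewrite pb_pM eqxx.
have [M [sM QM nz]] := simple_module_idempotent iQ pp (tail_ideal_p_notin mm Tz).
exists M; split=> //; apply/seteqP; split=> // a Ma.
have iM : ideal (annihilator M).
  by have [] := @primitive_ideal_prime A (annihilator M) (ex_intro _ M (conj sM erefl)).
apply: contrapT => nQa.
have [v [c [Tv nc hvc]]] := tail_uniqueness f_surj rfG sapG im nQa.
apply: nz; apply: (ideal_p_reach iM (hz v Tv)).
apply: (ideal_p_iota_inv iM mm _ nc).
  by move=> d md; apply: QM; apply: tail_ideal_iota.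
by apply: hvc => // _ ->.
Qed.

Definition tail_prim (Tm : MT G * MaxSpec C) : Prim A :=
  exist _ (tail_ideal Tm.1 (val Tm.2))
    (mem_set (tail_ideal_primitive Tm.1 (set_mem (valP Tm.2)))).

Lemma tail_primP T (m : MaxSpec C) v c :
  ~ val (tail_prim (T, m)) (p v * io c) <-> val T v /\ ~ val m c.
Proof.
have [im _ _] := set_mem (valP m).
have h := tail_ideal_p_iota f_surj rfG finG T v c im.
split=> [n|[Tv nc] /h[]//].
split; first by apply: contrapT => nTv; apply: n; apply/h; left.
by move=> mc; apply: n; apply/h; right.
Qed.

Lemma maxspec1 (m : MaxSpec C) : ~ val m 1.
Proof. by have [im /(ideal_proper im) h _] := set_mem (valP m). Qed.

Lemma tail_prim_le T (m : MaxSpec C) S (n : MaxSpec C) :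
  val (tail_prim (T, m)) `<=` val (tail_prim (S, n)) <->
  val S `<=` val T /\ m = n.
Proof.
split=> [le|[ST <-]]; last first.
  apply: tail_ideal_min; first exact: tail_ideal_ideal.
    by move=> v nTv; apply: tail_ideal_p => // /ST.
  exact: tail_ideal_iota.
have lt v c : val S v /\ ~ val n c -> val T v /\ ~ val m c.
  by move=> /tail_primP h; apply/tail_primP => /le.
have ST : val S `<=` val T.
  by move=> v Sv; have [] := lt v 1 (conj Sv (@maxspec1 n)).
split=> //; apply: val_inj.
have [[v Sv] _ _ _] := set_mem (valP S).
have mn : val m `<=` val n.
  move=> c mc; apply: contrapT => nc.
  by have [_] := lt v c (conj Sv nc).
have [_ _ mm] := set_mem (valP m); have [i_n pn _] := set_mem (valP n).
by have [->|/pn] := mm (val n) i_n mn.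
Qed.

Lemma tail_prim_inj : injective tail_prim.
Proof.
move=> [T m] [S n] e.
have [|ST mn] := (tail_prim_le T m S n).1; first by rewrite e.
have [|TS _] := (tail_prim_le S n T m).1; first by rewrite e.
by congr (_, _) => //; apply: val_inj; apply/seteqP; split.
Qed.

End TailPrimitive.

(** * Surjectivity over uncountable algebraically closed fields *)

Section Surjectivity.
Context (K : fieldType) (k l : nat) (f : {additive natv k -> natv l}).
Context (f_surj : forall n : natv l, exists m : natv k, f m = n).
Context (G : kgraph l) (rfG : row_finite G) (finG : finite_vertices G).
Context (sapG : strongly_aperiodic G).
Context (unK : ~ countable [set: K]) (acK : GRing.closed_field_axiom K).

Local Notation Lam := (pullback f G).
Local Notation A := (KP K Lam finG).
Local Notation C := (galg K (kerf f)).
Local Notation p := (pb_p K f finG).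
Local Notation io := (iota finG : C -> A).

Context (M : lmodType A) (sM : simple_module M).

Let iM : ideal (annihilator M).
Proof.
by have [] := @primitive_ideal_prime A (annihilator M) (ex_intro _ M (conj sM erefl)).
Qed.

Let M1 : ~ annihilator M 1.
Proof. by move=> h; have [[u nu] _] := sM; apply: nu; rewrite -(scale1r u) h. Qed.

Lemma iota_mod_scalar (c : C) : exists x : K, annihilator M (io (c - kc f x)).
Proof.
have k1 : zmod_morphism (@kc K k l f).
  move=> x y; have e : kc f (- y) = - kc f y.
    by apply/eqP; rewrite -subr_eq0 opprK -kcD addNr kc0.
  by rewrite kcD e.
have k2 : monoid_morphism (@kc K k l f).
  by split=> [|x y]; rewrite ?kc1 ?kcM.
have i1 : zmod_morphism io by move=> x y; rewrite iotaD iotaN.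
have i2 : monoid_morphism io.
  by split=> [|x y]; [exact: iota1 | exact: iotaM].
pose kcR : {rmorphism K -> C} := HB.pack (@kc K k l f)
  (GRing.isZmodMorphism.Build K C _ k1) (GRing.isMonoidMorphism.Build K C _ k2).
pose ioR : {rmorphism C -> A} := HB.pack io
  (GRing.isZmodMorphism.Build C A _ i1) (GRing.isMonoidMorphism.Build C A _ i2).
apply: (@central_character K k l f G finG C kcR ioR) => //.
  by move=> d x; apply: iota_central.
by move=> x; rewrite [LHS]iotaU pb_U0.
Qed.

Definition central_kernel : set C := [set c | annihilator M (io c)].

Lemma central_kernel_maximal : maximal_ideal central_kernel.
Proof.
have ik : ideal central_kernel.
  split; rewrite /central_kernel /mkset.
  - by rewrite iota0; apply: (ideal0 iM).
  - by move=> x y hx hy; rewrite iotaD; apply: (idealD iM).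
  - move=> a x hx.
    have e1 := iotaM rfG finG a x; have e2 := iotaM rfG finG x a.
    by split; [rewrite e1; exact: (idealMl _ iM)|rewrite e2; exact: (idealMr _ iM)].
split=> //.
  by move=> e; apply: M1; rewrite -(iota1 K f rfG finG) -[annihilator _ _]/(central_kernel 1) e.
move=> J iJ kJ.
have [Jk|/existsNP[c /not_implyP[Jc nc]]] := pselect (J `<=` central_kernel).
  by left; apply/seteqP; split.
right; apply/seteqP; split=> // d _.
(* [c] is a nonzero scalar modulo the kernel, hence a unit. *)
have [x hx] := iota_mod_scalar c.
have x0 : x != 0.
  by apply/eqP => x0; apply: nc; move: hx; rewrite x0 kc0 subr0.
have J1 : J 1.
  have -> : 1 = kc f x^-1 * (c + - (c - kc f x)).
    by rewrite opprB addrC subrK kcM mulVf // kc1.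
  by apply: (idealMl _ iJ); apply: (idealD iJ) => //; apply: (idealN iJ); apply: kJ.
by rewrite -[d]mulr1; apply: (idealMl _ iJ).
Qed.

Definition vertex_support : set (Obj G) := [set v | ~ annihilator M (p v)].

Lemma vertex_support_tail : maximal_tail vertex_support.
Proof.
have one : 1 = \sum_(v <- fset_set [set: Obj G]) p v :> A by [].
split.
- apply: contrapT => h; apply: M1; rewrite one; apply: ideal_sum => // v _.
  by apply: contrapT => nv; apply: h; exists v.
- move=> v w Tw vw h; apply: Tw; exact: (ideal_p_reach f_surj iM vw h).
- move=> v n Tv; apply: contrapT => /forall2NP h; apply: Tv.
  have [m fm] := f_surj n; rewrite -[p v]mulr1 (pb_one K f rfG finG m).
  rewrite mulr_sumr; apply: ideal_sum => // a.
  rewrite (in_paths_of_deg rfG finG) fm => /eqP da.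
  rewrite mulrA pb_pMs; case: eqP => [ra|_]; last by rewrite mul0r; apply: ideal0.
  have [[]//|/contrapT hsa] := h a.
  by rewrite -pb_sp -mulrA; apply: (idealMl _ iM); apply: (idealMr _ iM).
(* A simple module has no room for two orthogonal parts: some path joins the
  supports of [p v] and [p w], and its source is reached from both. *)
- move=> v w Tv Tw; have [u hu] : exists u : M, p w *: u <> 0 by apply/existsNP.
  have [x hx] : exists x, ~ annihilator M (p v * x * p w).
    have [y hy] : exists y : M, p v *: y <> 0 by apply/existsNP.
    have [x ex] := simple_cyclic sM hu y.
    by exists x => /(_ u); rewrite -!scalerA -ex.
  have [g [g0 gD fg]] := degree_section f_surj.
  have [N hN] := mul_long_path rfG gD fg x.
  have [a da nha] : exists2 a, deg a = N &
      ~ annihilator M (p v * x * (p w * gam K f finG g a)).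
    apply: contrapT => /forall2NP h; apply: hx.
    rewrite -[p w]mulr1 (gam_one K rfG finG fg N) !mulr_sumr.
    apply: ideal_sum => // a; rewrite in_paths_of_deg // => /eqP da.
    rewrite 2!mulrA -[_ * p w * _]mulrA; apply: (idealMr _ iM).
    by have [//|/contrapT] := h a.
  have ra : rng a = w.
    apply: contrapT => ne; apply: nha; rewrite pb_pMs.
    by case: eqP => // _; rewrite mulr0; apply: ideal0.
  have {}nha : ~ annihilator M (p v * (x * gam K f finG g a)).
    by move=> h; apply: nha; rewrite pb_pMs ra eqxx -mulrA.
  exists (src a); split; last by exists a.
    move=> h; apply: nha; rewrite mulrA -[gam _ _ _ _ a]pb_sp mulrA.
    exact: (idealMl _ iM).
  have [|r hr e] := hN 0 a; first by rewrite da addr0 lev_refl.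
  have [z zr rz] : exists2 z, z \in r & rng z.2 = v.
    apply: contrapT => /forall2NP h; apply: nha.
    rewrite e mulr_sumr; apply: ideal_sum => // z zr.
    rewrite mulrA -iota_central // -mulrA pb_pMs; case: eqP => [rz|_].
      by have [[]//|[]//] := h z.
    by rewrite mulr0; apply: ideal0.
  by exists z.2; split=> //; have [] := hr z zr.
Qed.

End Surjectivity.

(** * The homeomorphism *)

(** The sets [V] of the last hypothesis are gathered, in [trace U] below, into
  an open set that meets the range of [phi] in the image of [U]. *)
Lemma open_injection_homeomorphism (X Y : topologicalType) (phi : X -> Y) :
  injective phi -> continuous phi ->
  (forall (U : set X) x, open U -> U x -> exists V : set Y,
    [/\ open V, V (phi x) & forall x', V (phi x') -> U x']) ->
  homeomorphism_onto_image phi /\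
  ((forall y, exists x, phi x = y) -> homeomorphism phi).
Proof.
move=> phiI phiC phiO.
pose trace U : set Y :=
  \bigcup_(V in [set V : set Y | open V /\ forall x, V (phi x) -> U x]) V.
have trace_open U : open (trace U) by apply: bigcup_open => V [].
have traceE (U : set X) : open U -> forall x, trace U (phi x) <-> U x.
  move=> oU x; split=> [[V [_ VU] /VU //]|Ux].
  by have [V [oV Vx VU]] := phiO U x oU Ux; exists V.
have /continuousP phiC' := phiC; split.
- split; first by apply/continuousP => _ [V oV <-]; apply: phiC'.
  have /choice[psi hpsi] : forall y : range phi, exists x, phi x = val y.
    by move=> y; have [x _ e] := set_mem (valP y); exists x.
  exists psi; split.
  + by move=> x; apply: phiI; rewrite hpsi.
  + by move=> y; apply: val_inj; rewrite /= hpsi.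
  + apply/continuousP => U oU; exists (trace U) => //.
    by apply/seteqP; split=> y; have [] := traceE U oU (psi y); rewrite hpsi.
- move=> /choice[psi hpsi]; split=> //; exists psi; split.
  + by move=> x; apply: phiI; rewrite hpsi.
  + by move=> y; rewrite hpsi.
  + apply/continuousP => U oU; rewrite (_ : psi @^-1` U = trace U) //.
    by apply/seteqP; split=> y; have [] := traceE U oU (psi y); rewrite hpsi.
Qed.

Lemma prim_open_notin (A : pzRingType) (x : A) : open [set P : Prim A | ~ val P x].
Proof.
exists (ideal_gen [set x]); first exact: ideal_gen_ideal.
apply/seteqP; split=> P /= nPx h; apply: nPx; first by apply: h; apply: sub_ideal_gen.
have [M [sM PE]] := set_mem (valP P).
have [iP _ _] := @primitive_ideal_prime A (val P) (ex_intro _ M (conj sM PE)).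
by move=> y; apply=> // _ ->.
Qed.

Lemma maxspec_open_notin (C : comPzRingType) (c : C) :
  open [set m : MaxSpec C | ~ val m c].
Proof.
exists (ideal_gen [set c]); first exact: ideal_gen_ideal.
apply/seteqP; split=> m /= nmc h; apply: nmc; first by apply: h; apply: sub_ideal_gen.
have [im _ _] := set_mem (valP m).
by move=> y; apply=> // _ ->.
Qed.

Lemma mt_basis_open l (G : kgraph l) v : open (@MT_basis l G v).
Proof. by move=> T Tv; exists v. Qed.

Lemma prim_closure1 (A : pzRingType) (P Q : Prim A) :
  closure [set P] Q <-> val P `<=` val Q.
Proof.
split=> [h a Pa|PQ B].
  apply: contrapT => nQa.
  have [|R [-> /=]] := h [set R : Prim A | ~ val R a] => //.
  by apply: open_nbhs_nbhs; split=> //; apply: prim_open_notin.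
rewrite nbhsE => -[V [[I iI VE] VQ] VB]; exists P; split=> //; apply: VB.
move: VQ; rewrite VE => nIQ IP; apply: nIQ; exact: subset_trans PQ.
Qed.

Section TailHomeomorphism.
Context (K : fieldType) (k l : nat) (f : {additive natv k -> natv l}).
Context (f_surj : forall n : natv l, exists m : natv k, f m = n).
Context (G : kgraph l) (rfG : row_finite G) (finG : finite_vertices G).
Context (sapG : strongly_aperiodic G).

Local Notation C := (galg K (kerf f)).
Local Notation p := (pb_p K f finG).
Local Notation io := (iota finG).
Local Notation Phi := (tail_prim f_surj rfG finG sapG (K := K)).

(** A basic neighbourhood [S(v) x D(c)] is the set of the points at which the
  primitive ideal misses [p v * iota c]; by the uniqueness lemma, an element
  missed at a point yields such a product in the ideal that it generates. *)
Lemma tail_prim_continuous : continuous Phi.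
Proof.
apply/continuousP => _ [I iI ->].
rewrite openE => -[T m] /= /existsNP[a /not_implyP[Ia na]].
have [im _ _] := set_mem (valP m).
have [v [c [Tv nc hvc]]] := tail_uniqueness f_surj rfG sapG im na.
exists (MT_basis v, [set n : MaxSpec C | ~ val n c]) => /=.
  split; apply: open_nbhs_nbhs; split=> //; first exact: mt_basis_open.
  exact: maxspec_open_notin.
move=> [S n] /= [Sv nnc] h.
have /(tail_primP f_surj rfG finG sapG) := conj Sv nnc; apply.
by apply: h; apply: hvc => // _ ->.
Qed.

Lemma tail_prim_open (U : set (MT G * MaxSpec C)) x : open U -> U x ->
  exists V : set (Prim (KP K (pullback f G) finG)),
    [/\ open V, V (Phi x) & forall x', V (Phi x') -> U x'].
Proof.
case: x => T m oU UTm.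
have [[B D] /= [nB nD] BDU] : nbhs (T, m) U by apply: open_nbhs_nbhs.
move: nB; rewrite nbhsE => -[B' [oB' B'T] BB].
move: nD; rewrite nbhsE => -[D' [oD' D'm] DD].
have [v Tv vB] := oB' T B'T.
have [J iJ DE] := oD'.
move: D'm; rewrite DE => /existsNP[c /not_implyP[Jc nc]].
exists [set P : Prim _ | ~ val P (p v * io c)]; split.
- exact: prim_open_notin.
- exact/tail_primP.
- move=> [S n] /tail_primP[Sv nnc]; apply: BDU; split => /=.
    by apply: BB; apply: vB.
  by apply: DD; rewrite DE /= => h; apply: nnc; apply: h.
Qed.

Lemma tail_prim_surj : ~ countable [set: K] -> GRing.closed_field_axiom K ->
  forall P, exists Tm, Phi Tm = P.
Proof.
move=> unK acK P; have [M [sM PE]] := set_mem (valP P).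
have mm := central_kernel_maximal rfG unK acK sM.
pose T : MT G := exist (fun X : set (Obj G) => X \in @maximal_tail l G)
  (vertex_support M) (mem_set (vertex_support_tail f_surj rfG sM)).
pose m : MaxSpec C := exist (fun X : set C => X \in @maximal_ideal C)
  (central_kernel M) (mem_set mm).
exists (T, m); apply: val_inj; rewrite PE.
have iM : ideal (annihilator M).
  by have [] := @primitive_ideal_prime _ (annihilator M) (ex_intro _ M (conj sM erefl)).
apply/seteqP; split=> [|a Ma].
  apply: tail_ideal_min => // v; exact: contrapT.
apply: contrapT => na.
have [im _ _] := mm.
have [v [c [Tv nc hvc]]] := tail_uniqueness f_surj rfG sapG im na.
apply: Tv; apply: (ideal_p_iota_inv rfG iM mm _ nc) => //.
by apply: hvc => // _ ->.
Qed.

End TailHomeomorphism.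

Theorem theorem5p3
  (K : fieldType) (k l : nat) (f : {additive natv k -> natv l})
  (f_surj : forall n : natv l, exists m : natv k, f m = n)
  (G : kgraph l) (row_finiteG : row_finite G) (no_sourcesG : no_sources G)
  (finG : finite_vertices G) (aperiodicG : strongly_aperiodic G) :
  exists Phi : MT G * MaxSpec (galg K (kerf f)) ->
               Prim (KP K (pullback f G) finG),
    [/\ forall T m, val (Phi (T, m)) = P_ideal K f finG T m,
        homeomorphism_onto_image Phi
      & ~ countable [set: K] -> GRing.closed_field_axiom K ->
        homeomorphism Phi /\
        forall T m, closure [set Phi (T, m)] =
          [set Phi (S, m) | S in [set S : MT G | val S `<=` val T]]].
Proof.
have [onto homeo] := open_injection_homeomorphism
  (@tail_prim_inj K k l f f_surj G row_finiteG finG aperiodicG)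
  (@tail_prim_continuous K k l f f_surj G row_finiteG finG aperiodicG)
  (@tail_prim_open K k l f f_surj G row_finiteG finG aperiodicG).
exists (tail_prim f_surj row_finiteG finG aperiodicG (K := K)); split=> // unK acK.
have surj := tail_prim_surj f_surj row_finiteG aperiodicG (finG := finG) unK acK.
split; first exact: homeo.
move=> T m; apply/seteqP; split=> [Q /prim_closure1|_ [S ST <-]].
  have [[S n] <-] := surj Q => /tail_prim_le[ST <-].
  by exists S.
by apply/prim_closure1/tail_prim_le.
Qed.
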